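(* Let $\mathcal{S}^d$ be the space of real symmetric $d\times d$ matrices with inner product $\langle X,Y\rangle=\mathrm{trace}(XY)$, $s_d:=d(d+1)/2$, and $K:=\mathcal{S}^d_+\subset\mathcal{S}^d$ the cone of positive semidefinite matrices. Let $m\le d$ with $m<s_d$, let $A_1,\dots,A_m\in\mathcal{S}^d$ be linearly independent, and let $A_0\in\mathrm{int}(K)$. Let $\Omega:=\mathrm{int}(K)$, let $h:\mathcal{S}^d\to\mathbb{R}^m$ be $h(X):=(\langle A_j,X\rangle)_{j=1,\dots,m}$, and assume that the constant $j_h=\sqrt{\det\big((\langle A_i,A_j\rangle)_{1\le i,j\le m}\big)}$ is strictly positive. Let $P$ be the probability measure on $\Omega$ $$P(dX)=p(X)\,dX=s\,e^{-\langle A_0,X\rangle}\,dX,\qquad 1/s:=\int_K e^{-\langle A_0,X\rangle}\,dX,$$ and let $$\Theta(y):=\inf_{Q\ll P}\Big\{\int_\Omega q(X)\ln\frac{q(X)}{p(X)}\,dX:\ \int_\Omega\langle A_j,X\rangle\,dQ(X)=y_j,\ j=1,\dots,m\Big\},$$ the infimum being over probability measures $Q(dX)=q(X)\,dX$ on $\Omega$ absolutely continuous with respect to $P$. Let $y\in\mathrm{int}(h(K))$. Then for every $\varepsilon>0$, the perspective function $\widetilde\Theta(y,\varepsilon):=\varepsilon\,\Theta(y/\varepsilon)$ is, up to the constant $-\varepsilon\ln s$, the optimal value of the log-barrier problem of the dual semidefinite program; that is, $$\widetilde\Theta(y,\varepsilon)=-\varepsilon\ln s+\tau^*_\varepsilon(y),\qquad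 \tau^*_\varepsilon(y):=\sup_{\lambda\in\mathbb{R}^m}\Big\{\langle\lambda,y\rangle-\varepsilon\,\varphi\Big(A_0-\sum_{j=1}^m\lambda_jA_j\Big):\ A_0-\sum_{j=1}^m\lambda_jA_j\in K\Big\}.$$ In particular, $$\tau^*(y)=\widetilde\Theta(y,0):=\lim_{r\downarrow0}r\,\Theta(y/r),\qquad\text{where}\quad \tau^*(y):=\sup_{\lambda\in\mathbb{R}^m}\Big\{\langle\lambda,y\rangle:\ A_0-\sum_{j=1}^m\lambda_jA_j\in K\Big\}.$$
   Context: $dX$ is Lebesgue measure on $\mathcal{S}^d\cong\mathbb{R}^{s_d}$ associated with the trace inner product. The log-barrier function is $\varphi(V):=\ln\left(\int_K e^{-\langle V,X\rangle}\,dX\right)=C_d-\frac{d+1}{2}\ln\det(V)$ for $V\in\mathrm{int}(K)$, with $C_d$ a constant depending only on $d$; $\varphi=+\infty$ on the boundary of $K$ (where the integral diverges). The set $\mathrm{int}(h(K))$ is the interior in $\mathbb{R}^m$ of $h(K)=\{h(X):X\in K\}$. *)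

(* Defs.v *)
From HB Require Import structures.
From mathcomp Require Import all_boot all_order all_algebra.
From mathcomp Require Import all_classical all_reals all_analysis.
From mathcomp Require Import measurable_realfun.
Set Implicit Arguments.
Unset Strict Implicit.
Unset Printing Implicit Defensive.
Import Order.TTheory GRing.Theory Num.Theory.
Import numFieldNormedType.Exports.
Local Open Scope classical_set_scope.
Local Open Scope ring_scope.

Section cons_lebesgue.
Context (R : realType) (n : nat).
Variable mu : {sigma_finite_measure set (n.-tuple R) -> \bar R}.

Definition cons_pair (x : R * n.-tuple R) : n.+1.-tuple R :=
  [the n.+1.-tuple R of x.1 :: x.2].

Lemma measurable_cons_pair : measurable_fun setT cons_pair.
Proof.
apply: measurable_cons; first exact: measurable_fst.
exact: measurable_snd.
Qed.

Definition cons_lebesgue : set (n.+1.-tuple R) -> \bar R :=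
  pushforward (@lebesgue_measure R \x mu)%E cons_pair.

Let cons0 : cons_lebesgue set0 = 0%E.
Proof. by apply: measure0; exact: measurable_cons_pair. Qed.

Let cons_ge0 A : (0 <= cons_lebesgue A)%E.
Proof. by apply: measure_ge0; exact: measurable_cons_pair. Qed.

Let cons_additive : semi_sigma_additive cons_lebesgue.
Proof. by apply: measure_semi_sigma_additive; exact: measurable_cons_pair. Qed.

HB.instance Definition _ :=
  isMeasure.Build _ _ _ cons_lebesgue cons0 cons_ge0 cons_additive.

Let cons_sigma_finite : sigma_finite setT cons_lebesgue.
Proof.
have [F [UF ndF Foo]] := (sigma_finiteP _ _).1 (sigma_finiteT (@lebesgue_measure R)).
have [G [UG ndG Goo]] := (sigma_finiteP _ _).1 (sigma_finiteT mu).
pose g (t : n.+1.-tuple R) : R * n.-tuple R := (thead t, [tuple of behead t]).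
have gK : cancel cons_pair g.
  by case=> a t; rewrite /g /cons_pair /=; congr pair; exact: val_inj.
have mg : measurable_fun setT g.
  apply/measurable_fun_pairP; split => /=; first exact: measurable_tnth.
  exact: measurable_behead.
exists (fun i => g @^-1` (F i `*` G i)).
  rewrite -preimage_bigcup; apply/esym; rewrite -subTset => t _.
  have : setT (g t).1 by []. rewrite UF => -[i _ Fi].
  have : setT (g t).2 by []. rewrite UG => -[j _ Gj].
  exists (maxn i j) => //; split.
    exact: (subsetPset _ _ (ndF _ _ (leq_maxl i j))).
  exact: (subsetPset _ _ (ndG _ _ (leq_maxr i j))).
move=> i; have [mF Foo'] := Foo i; have [mG Goo'] := Goo i; split.
  by rewrite -[X in measurable X]setTI; apply: mg => //; exact: measurableX.
rewrite /cons_lebesgue /pushforward -comp_preimage.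
rewrite (_ : g \o cons_pair = id); last by apply/funext => x; exact: gK.
by rewrite preimage_id product_measure1E// lte_mul_pinfty// ge0_fin_numE.
Qed.

HB.instance Definition _ :=
  Measure_isSigmaFinite.Build _ _ _ cons_lebesgue cons_sigma_finite.

End cons_lebesgue.

(* Lebesgue measure on R^n, built as an iterated product; there is none in the
   library for general n. *)
Fixpoint lebesgue_tuple (R : realType) (n : nat) :
    {sigma_finite_measure set (n.-tuple R) -> \bar R} :=
  if n is n'.+1 then cons_lebesgue (lebesgue_tuple R n') else \d_[tuple].

(* Symmetric matrices form the subspace of 'M[R]_d fixed by transposition; see
   [mem_symv]. The type [sym R d] is this space with the topology induced by
   'M[R]_d and the corresponding Borel sigma-algebra. *)
Definition symv (R : realType) (d : nat) : {vspace 'M[R]_d} :=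
  fixedSpace (linfun (@trmx R d d)).

Lemma mem_symv (R : realType) (d : nat) (M : 'M[R]_d) :
  (M \in symv R d) = (M^T == M).
Proof. by apply/fixedSpaceP/eqP; rewrite lfunE. Qed.

Definition sym (R : realType) (d : nat) : Type := subvs_of (symv R d).
HB.instance Definition _ (R : realType) (d : nat) := Vector.on (sym R d).

Definition mx_of_sym (R : realType) (d : nat) (X : sym R d) : 'M[R]_d := vsval X.

HB.instance Definition _ (R : realType) (d : nat) :=
  Topological.copy (sym R d) (initial_topology (@mx_of_sym R d)).
HB.instance Definition _ (R : realType) (d : nat) := isPointed.Build (sym R d) 0.
HB.instance Definition _ (R : realType) (d : nat) :=
  Measurable.copy (sym R d) (g_sigma_algebraType (@open (sym R d))).

Definition trip (R : realType) (d : nat) (X Y : sym R d) : R :=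
  \tr (mx_of_sym X *m mx_of_sym Y).

(* The matrices E_ii and (E_ij + E_ji) / sqrt 2 for i < j form an orthonormal
   basis of [sym R d] for [trip]: see [card_upper] and [trip_basis_sym]. *)
Definition upper (d : nat) : {set 'I_d * 'I_d} :=
  finset (fun ij : 'I_d * 'I_d => (ij.1 <= ij.2)%N).

Lemma measurable_preimage_open_mx d (T : measurableType d) (R : realType) m n
    (f : T -> 'M[R]_(m, n)) (V : set 'M[R]_(m, n)) :
  (forall i j, measurable_fun setT (fun x => f x i j)) ->
  open V -> measurable (f @^-1` V).
Proof.
move=> mf oV.
pose box (ab : 'M[rat]_(m, n) * 'M[rat]_(m, n)) : set 'M[R]_(m, n) :=
  [set N | forall i j, N i j \in `]ratr (ab.1 i j), ratr (ab.2 i j)[].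
pose F ab := [set x | box ab `<=` V /\ box ab (f x)].
rewrite (_ : f @^-1` V = \bigcup_ab F ab); last first.
  apply/seteqP; split=> [x Vfx|x [ab _ [abV]]]; last exact: abV.
  have : nbhs (f x) V by exact: open_nbhs_nbhs.
  move=> [P fP PV].
  have /choice[g gP] (ij : 'I_m * 'I_n) : exists ab : rat * rat,
      (f x ij.1 ij.2 \in `]ratr ab.1, ratr ab.2[) /\
      (forall z, z \in `]ratr ab.1, ratr ab.2[ -> P ij.1 ij.2 z).
    have /nbhs_ballP[e /= e0 eP] := fP ij.1 ij.2.
    set y := f x ij.1 ij.2 in eP *.
    have ye : y - e < y by rewrite gtrBl.
    have ye' : y < y + e by rewrite ltrDl.
    have [a] := rat_in_itvoo ye; rewrite in_itv/= => /andP[a1 a2].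
    have [b] := rat_in_itvoo ye'; rewrite in_itv/= => /andP[b1 b2].
    exists (a, b); split; first by rewrite in_itv/= a2 b1.
    move=> z /=; rewrite in_itv/= => /andP[az zb]; apply: eP.
    by rewrite /ball/= ltr_distlC (lt_trans a1 az) (lt_trans zb b2).
  exists (\matrix_(i, j) (g (i, j)).1, \matrix_(i, j) (g (i, j)).2) => //; split.
    move=> N /= Nbox; apply: PV => i j; apply: (gP (i, j)).2.
    by have := Nbox i j; rewrite !mxE.
  by move=> i j /=; rewrite !mxE; exact: (gP (i, j)).1.
apply: countable_bigcupT_measurable => [|ab]; first exact: countableP.
have [abV|abV] := pselect (box ab `<=` V); last first.
  by rewrite (_ : F ab = set0)//; apply/seteqP; split=> // x [].
rewrite (_ : F ab = \bigcap_(ij in [set: 'I_m * 'I_n])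
    ((fun x => f x ij.1 ij.2) @^-1`
       [set` `]ratr (ab.1 ij.1 ij.2), ratr (ab.2 ij.1 ij.2)[])).
  apply: fin_bigcap_measurable => // -[i j] _ /=.
  by rewrite -[X in measurable X]setTI; apply: mf => //; exact: measurable_itv.
apply/seteqP; split=> [x [_ fx] [i j] _|x fx]; first exact: fx.
by split=> // i j; exact: (fx (i, j)).
Qed.

Section trace_basis.
Context (R : realType) (d : nat).

Definition basis_mx (ij : 'I_d * 'I_d) : 'M[R]_d :=
  if ij.1 == ij.2 then delta_mx ij.1 ij.1
  else (Num.sqrt 2)^-1 *: (delta_mx ij.1 ij.2 + delta_mx ij.2 ij.1).

Lemma basis_mx_sym ij : basis_mx ij \in symv R d.
Proof.
rewrite mem_symv /basis_mx; case: ifP => _; first by rewrite trmx_delta.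
by rewrite linearZ/= linearD/= !trmx_delta addrC.
Qed.

Definition basis_sym ij : sym R d := Subvs (basis_mx_sym ij).

Definition sym_of_coord (t : #|upper d|.-tuple R) : sym R d :=
  \sum_(k < #|upper d|) tnth t k *: basis_sym (enum_val k).

Lemma measurable_sym_of_coord : measurable_fun setT sym_of_coord.
Proof.
apply: (@measurability _ _ _ _ _ _ (@open (sym R d))) => // _ [_ [V oV <-] <-].
rewrite setTI -comp_preimage; apply: measurable_preimage_open_mx => // i j.
rewrite (_ : (fun x => _) = fun t : #|upper d|.-tuple R =>
  \sum_(k < #|upper d|) tnth t k * basis_mx (enum_val k) i j).
  apply: measurable_sum => k; apply: measurable_funM => //.
  exact: measurable_tnth.
apply/funext => t /=; rewrite /mx_of_sym /sym_of_coord linear_sum/= summxE.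
by apply: eq_bigr => k _; rewrite mxE.
Qed.

Lemma card_upper : #|upper d| = (d * d.+1)./2.
Proof.
rewrite -sum1_card big_mkcond /=.
transitivity (\sum_(i < d) \sum_(j < d) (j <= i : nat)).
  rewrite exchange_big pair_bigA /=; apply: eq_bigr => -[i j] _ /=.
  by rewrite inE; case: leqP.
have sumS n : (\sum_(i < n) i.+1).*2 = (n * n.+1)%N.
  elim: n => [|n IHn]; first by rewrite big_ord0.
  by rewrite big_ord_recr /= doubleD IHn -mul2n -mulnDl addn2 mulnC.
rewrite -(sumS d) doubleK; apply: eq_bigr => i _.
rewrite -[RHS]card_ord -sum1_card (big_ord_widen d (fun=> 1%N) (ltn_ord i)).
by rewrite [RHS]big_mkcond; apply: eq_bigr => j _; rewrite ltnS; case: leqP.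
Qed.

Lemma trip_basis_sym ij kl : ij \in upper d -> kl \in upper d ->
  trip (basis_sym ij) (basis_sym kl) = (ij == kl)%:R.
Proof.
have tr_delta (M : 'M[R]_d) i j : \tr (delta_mx i j *m M) = M j i.
  rewrite /mxtrace (bigD1 i)//= big1 ?addr0 => [|k ki].
    rewrite mxE (bigD1 j)//= big1 ?addr0 => [|k kj].
      by rewrite mxE !eqxx mul1r.
    by rewrite mxE (negbTE kj) andbF mul0r.
  by rewrite mxE big1// => l _; rewrite mxE (negbTE ki) mul0r.
case: ij kl => [i j] [k l]; rewrite !inE /= => ij kl.
have s2 : (Num.sqrt 2)^-1 * (Num.sqrt 2)^-1 = 2^-1 :> R.
  by rewrite -invfM -expr2 sqr_sqrtr.
rewrite /trip /mx_of_sym /= {1}/basis_mx /= xpair_eqE.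
have [eij|nij] := eqVneq i j; last rewrite -scalemxAl mxtraceZ mulmxDl mxtraceD.
  subst j; rewrite tr_delta /basis_mx /=; have [ekl|nkl] := eqVneq k l.
    by subst l; rewrite mxE andbb.
  rewrite !mxE; case: (eqVneq i k) => [ik|_] /=; last first.
    by rewrite andbF addr0 mulr0.
  by subst k; rewrite (negbTE nkl) addr0 mulr0.
rewrite !tr_delta /basis_mx /=; have [ekl|nkl] := eqVneq k l.
  subst l; rewrite !mxE (eq_sym j) -(andbC (i == k)).
  case: eqVneq => [ik|] /=; last by rewrite addr0 mulr0.
  by subst k; rewrite (negbTE nij) addr0 mulr0.
rewrite !mxE.
have jkil : (j == k) && (i == l) = false.
  apply/negbTE/negP => /andP[/eqP jk /eqP il]; subst k l.
  by move: nij; rewrite -val_eqE eqn_leq ij kl.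
rewrite (andbC (j == l)) (andbC (i == l)) jkil add0r addr0 -mulrDr mulrA s2.
by case: (_ && _); rewrite ?addr0 ?mulr0// -mulr2n -mulr_natr mul1r mulVf.
Qed.

(* The basis used by [sym_of_coord] is orthonormal, so this is the Lebesgue
   measure normalized by the trace inner product: unit cubes have mass 1. *)
Definition lebesgue_sym : set (sym R d) -> \bar R :=
  pushforward (lebesgue_tuple R #|upper d|) sym_of_coord.

Let lebesgue_sym0 : lebesgue_sym set0 = 0%E.
Proof. by apply: measure0; exact: measurable_sym_of_coord. Qed.

Let lebesgue_sym_ge0 B : (0 <= lebesgue_sym B)%E.
Proof. by apply: measure_ge0; exact: measurable_sym_of_coord. Qed.

Let lebesgue_sym_additive : semi_sigma_additive lebesgue_sym.
Proof. by apply: measure_semi_sigma_additive; exact: measurable_sym_of_coord. Qed.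

HB.instance Definition _ := isMeasure.Build _ _ _ lebesgue_sym
  lebesgue_sym0 lebesgue_sym_ge0 lebesgue_sym_additive.

End trace_basis.

Section semidefinite_program.
Context (R : realType) (d m : nat).
Implicit Types (V X : sym R d) (A : 'I_m -> sym R d) (y lam : 'rV[R]_m).

Definition psd : set (sym R d) :=
  [set X | forall v : 'cV[R]_d, 0 <= (v^T *m mx_of_sym X *m v) 0 0].

Definition pd : set (sym R d) := interior psd.

Definition laplace V : \bar R :=
  (\int[@lebesgue_sym R d]_(X in psd) (expR (- trip V X))%:E)%E.

(* [lne +oo = +oo], so this is +oo where the integral diverges. *)
Definition log_barrier V : \bar R := lne (laplace V).

Definition gibbs_const V : R := (fine (laplace V))^-1.

Definition gibbs_pdf V X : R := gibbs_const V * expR (- trip V X).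

Definition gibbs V (B : set (sym R d)) : \bar R :=
  (\int[@lebesgue_sym R d]_(X in B `&` pd) (gibbs_pdf V X)%:E)%E.

Definition is_pdf (Q : set (sym R d) -> \bar R) (q : sym R d -> R) : Prop :=
  [/\ measurable_fun pd q,
      (forall X, pd X -> 0 <= q X) &
      forall B, measurable B ->
        Q B = (\int[@lebesgue_sym R d]_(X in B `&` pd) (q X)%:E)%E].

(* [ln 0 = 0], hence 0 ln 0 = 0. The negative part of the integrand is at most
   [p], so the integral is never of the form +oo - oo. *)
Definition rel_entropy (q p : sym R d -> R) : \bar R :=
  (\int[@lebesgue_sym R d]_(X in pd) (q X * ln (q X / p X))%:E)%E.

Definition hmap A X : 'rV[R]_m := \row_j trip (A j) X.

Definition has_moments (Q : set (sym R d) -> \bar R) A y : Prop :=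
  forall j, Q.-integrable pd (fun X => (trip (A j) X)%:E) /\
    (\int[Q]_(X in pd) (trip (A j) X)%:E)%E = (y 0 j)%:E.

Definition Theta (A0 : sym R d) A y : \bar R :=
  ereal_inf [set v | exists (Q : probability (sym R d) R) (q : sym R d -> R),
    [/\ Q `<< gibbs A0, is_pdf Q q, has_moments Q A y &
        v = rel_entropy q (gibbs_pdf A0)]].

Definition perspective (F : 'rV[R]_m -> \bar R) y (e : R) : \bar R :=
  (e%:E * F (e^-1 *: y)%R)%E.

Definition dotp lam y : R := \sum_(j < m) lam 0 j * y 0 j.

Definition slack (A0 : sym R d) A lam : sym R d :=
  A0 - \sum_(j < m) lam 0 j *: A j.

Definition tau (A0 : sym R d) A y : \bar R :=
  ereal_sup [set (dotp lam y)%:E | lam in [set lam | psd (slack A0 A lam)]].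

Definition tau_eps (A0 : sym R d) A (e : R) y : \bar R :=
  ereal_sup [set ((dotp lam y)%:E - e%:E * log_barrier (slack A0 A lam))%E
            | lam in [set lam | psd (slack A0 A lam)]].

Definition gram_jacobian A : R :=
  Num.sqrt (\det (\matrix_(i < m, j < m) trip (A i) (A j))).

End semidefinite_program.
Arguments psd : clear implicits.
Arguments pd : clear implicits.

(* Main.v *)
Require Import Defs.
From HB Require Import structures.
From mathcomp Require Import all_boot all_order all_algebra.
From mathcomp Require Import all_classical all_reals all_analysis.
From mathcomp Require Import measurable_realfun ring lra.
Import Order.TTheory GRing.Theory Num.Theory.
Import numFieldNormedType.Exports.
Local Open Scope classical_set_scope.
Local Open Scope ring_scope.

(** The entropy problem is a convex program whose Lagrange dual is the
log-barrier problem, and the theorem is strong duality for this pair followed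
by the limit of vanishing barrier weight.  Write K for the cone of positive
semidefinite matrices, S(lam) = A0 - sum lam_j A_j for the slack, Z(V) for the
Laplace transform of K at V, and phi = ln Z.

Weak duality is the pointwise inequality q ln(q/p) >= q ln(r/p) + q - r
([entropy_lower]) with r = exp(-<S(lam), X>) / Z(S(lam)): since ln(r/p) is an
affine function of the constrained moments, integration gives
<lam, y> - phi(S(lam)) - ln s as a lower bound for every feasible q
([weak_duality]).

For strong duality one minimises G(lam) = exp(-<lam, y>) Z(S(lam)), the
exponential of minus the dual objective.  It is lower semicontinuous by Fatou
([dual_obj_lsc]).  It is coercive because y is interior to h(K): a finite value
of G forces S(lam) into K, hence <S(lam), X> >= 0 for matrices X whose moments
are y and y +- del e_j, and these inequalities bound lam
([dual_obj_coercive]).  So G attains its minimum, and the minimiser has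
S(lam) in int K, because Z is finite only there ([laplace_lty_pd]).  Around
such a point Z can be differentiated, and the vanishing of the gradient of G
says exactly that the exponential density r has moments y ([first_order]).
This density is feasible and its entropy equals the dual value
([primal_point], [strong_duality]).  Homogeneity turns the statement at
y / eps into the one for the barrier weight eps ([perspective_tau_eps]).

In the limit, every lam with S(lam) in int K gives <lam, y> as a lower bound,
and shrinking lam towards 0 reaches all feasible lam.  The upper bound uses
phi(S) >= ln b - <S, X0> / 2, where X0 in int K has moments y: as <S(lam), X0>
is a constant minus <lam, y>, the barrier changes the objective by at most
eps times an affine function of <lam, y> ([cvg_regularized_sup]).

The facts about Z come from translating the domain of integration: K + W is contained in K for W in K, and shifting by W
multiplies the integral by exp(-<V, W>) ([laplace_shift]).  This identifies the
domain of finiteness of Z and shows that the boundary of K is a null set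
([psd_setD_pd_null]). *)

Set Implicit Arguments.
Unset Strict Implicit.
Unset Printing Implicit Defensive.

(** * Lebesgue measure on tuples *)

Lemma lebesgue_measure_shift (R : realType) (c : R) (B : set R) : measurable B ->
  pushforward lebesgue_measure ((fun x => x + c) : R -> measurableTypeR R) B =
    lebesgue_measure B.
Proof.
have mc : measurable_fun setT ((fun x => x + c) : R -> measurableTypeR R).
  exact: measurable_funD.
move=> mB; apply/esym/lebesgue_measure_unique => //= _ [[a b] _ <-].
rewrite /pushforward /=.
have -> : (fun x : R => x + c) @^-1` `]a, b]%classic = `]a - c, b - c]%classic.
  by apply/seteqP; split=> x /=; rewrite !in_itv/= ltrBlDr lerBrDr.
rewrite !lebesgue_measure_itv/= !lte_fin ltrD2r; case: ifP => // _.
by rewrite -!EFinB; congr (_%:E); ring.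
Qed.

Lemma ge0_integral_shift (R : realType) (c : R) (f : R -> \bar R) :
  measurable_fun setT f -> (forall x, 0 <= f x)%E ->
  (\int[lebesgue_measure]_x f (x + c)%R = \int[lebesgue_measure]_x f x)%E.
Proof.
move=> mf f0.
have mc : measurable_fun setT ((fun x => x + c) : R -> measurableTypeR R).
  exact: measurable_funD.
transitivity (\int[pushforward lebesgue_measure
    ((fun x => x + c)%R : R -> measurableTypeR R)]_x f x)%E.
  by rewrite ge0_integral_pushforward.
by apply: eq_measure_integral => B mB _; exact: lebesgue_measure_shift.
Qed.

Section tuple_measure.
Context (R : realType).

Definition addt n (s t : n.-tuple R) : n.-tuple R :=
  [tuple tnth s i + tnth t i | i < n].

Lemma tnth_lift0 n (c : n.+1.-tuple R) (j : 'I_n) :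
  tnth c (lift ord0 j) = tnth [tuple of behead c] j.
Proof. by rewrite !(tnth_nth 0) /= nth_behead. Qed.

(** One step of the recursive definition of [lebesgue_tuple], via Tonelli; the
results below are inductions along it. *)
Lemma ge0_integral_cons n (f : n.+1.-tuple R -> \bar R) :
  measurable_fun setT f -> (forall t, 0 <= f t)%E ->
  (\int[lebesgue_tuple R n.+1]_t f t =
   \int[lebesgue_measure]_x \int[lebesgue_tuple R n]_t f (cons_pair (x, t)))%E.
Proof.
move=> mf f0.
transitivity (\int[pushforward (lebesgue_measure \x lebesgue_tuple R n)
    (@cons_pair R n)]_t f t)%E => //.
rewrite ge0_integral_pushforward//; last exact: measurable_cons_pair.
rewrite preimage_setT fubini_tonelli1//; last by move=> z; exact: f0.
by apply: measurableT_comp => //; exact: measurable_cons_pair.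
Qed.

Lemma measurable_addt n (c : n.-tuple R) : measurable_fun setT (fun t => addt t c).
Proof.
apply/measurable_fun_tnthP => i.
rewrite (_ : _ \o _ = fun t : n.-tuple R => tnth t i + tnth c i); last first.
  by apply/funext => t /=; rewrite tnth_mktuple.
by apply: measurable_funD => //; exact: measurable_tnth.
Qed.

Lemma ge0_integral_addt n (c : n.-tuple R) (f : n.-tuple R -> \bar R) :
  measurable_fun setT f -> (forall t, 0 <= f t)%E ->
  (\int[lebesgue_tuple R n]_t f (addt t c) = \int[lebesgue_tuple R n]_t f t)%E.
Proof.
elim: n c f => [|n IH] c f mf f0.
  by apply: eq_integral => t _; rewrite tuple0 [t]tuple0.
rewrite !ge0_integral_cons//; last first.
  by apply: (measurableT_comp mf); exact: measurable_addt.
pose c' : n.-tuple R := [tuple of behead c].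
have addtc x t : addt (cons_pair (x, t)) c = cons_pair (x + thead c, addt t c').
  apply: eq_from_tnth => i; rewrite tnth_mktuple.
  case: (unliftP ord0 i) => [j|] ->; last by rewrite /cons_pair /= !tnth0.
  rewrite /cons_pair /= !tnthS tnth_mktuple; congr (_ + _).
  exact: tnth_lift0.
pose g x := (\int[lebesgue_tuple R n]_t f (cons_pair (x, t)))%E.
have mfc : measurable_fun setT (f \o @cons_pair R n).
  by apply: measurableT_comp => //; exact: measurable_cons_pair.
rewrite -(@ge0_integral_shift _ (thead c) g)//.
- apply: eq_integral => x _; rewrite /g.
  under eq_integral do rewrite addtc.
  rewrite (IH c' (fun t => f (cons_pair (x + thead c, t))))//.
  exact: (measurableT_comp mfc (measurable_pair1 _)).
- by apply: (measurable_fun_fubini_tonelli_F _ mfc) => z; exact: f0.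
- by move=> x; exact: integral_ge0.
Qed.

(** Boxes are where positivity of the measure is visible; nonempty open sets of
symmetric matrices inherit it because they contain the image of a box. *)
Lemma lebesgue_tuple_box_gt0 n (c : n.-tuple R) (e : R) : 0 < e ->
  (0 < lebesgue_tuple R n [set t | forall i, (`|tnth t i - tnth c i| < e)%R])%E.
Proof.
move=> e0; elim: n c => [|n IH] c.
  by rewrite /= diracE mem_set ?lte01//= => -[].
pose B1 : set R := ball (thead c) e.
pose B2 := [set t : n.-tuple R | forall i, `|tnth t i - tnth [tuple of behead c] i| < e].
have mB2 : measurable B2.
  rewrite (_ : B2 = \bigcap_(i in [set: 'I_n])
      ((fun t => tnth t i) @^-1` ball (tnth [tuple of behead c] i) e)).
    apply: fin_bigcap_measurable => // i _; rewrite -[X in measurable X]setTI.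
    by apply: measurable_tnth => //; exact: measurable_ball.
  apply/seteqP; split=> t h i; last by have := h i I; rewrite /ball/= distrC.
  by move=> _; rewrite /= /ball/= distrC; exact: h.
rewrite /= /cons_lebesgue /pushforward.
rewrite (_ : _ @^-1` _ = B1 `*` B2); last first.
  apply/seteqP; split=> -[x t] /=; rewrite /cons_pair /=.
    move=> h; split; first by have := h ord0; rewrite /B1/ball/= distrC !tnth0.
    by move=> i; have := h (lift ord0 i); rewrite tnthS tnth_lift0.
  move=> [h1 h2] i; case: (unliftP ord0 i) => [j|] ->.
    by rewrite tnthS tnth_lift0; exact: h2.
  by move: h1; rewrite /B1/ball/= distrC tnth0.
rewrite product_measure1E//; last exact: measurable_ball.
have B1E : lebesgue_measure B1 = (e *+ 2)%:E.
  by apply: lebesgue_measure_ball; exact: ltW.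
by rewrite mule_gt0 ?IH// [X in (0 < X)%E]B1E lte_fin pmulrn_lgt0.
Qed.

Lemma integral_expR_norm_lty (c : R) : 0 < c ->
  (\int[lebesgue_measure]_x (expR (- (c * `|x|)))%:E < +oo)%E.
Proof.
move=> c0; rewrite ge0_symfun_integralT; first last.
- by move=> x /=; rewrite normrN.
- move=> x; apply: continuous_comp; last exact: continuous_expR.
  apply: continuousN; apply: continuousM; first exact: cst_continuous.
  exact: norm_continuous.
- by move=> x; exact: expR_ge0.
have mD : measurable [set x : R | 0 <= x] by rewrite -set_itvcy.
apply: lte_mul_pinfty => //.
apply: (@le_lt_trans _ _ (\int[lebesgue_measure]_x
  ((c^-1)%:E * (exponential_pdf c x)%:E))%E).
  rewrite [leLHS]integral_mkcond; apply: ge0_le_integral => //.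
  - by move=> x _; apply: erestrict_ge0 => y _; rewrite lee_fin expR_ge0.
  - apply/(measurable_restrictT _ _).1 => //; apply/measurable_EFinP.
    by apply: measurableT_comp => //; apply: measurableT_comp => //;
      apply: measurable_funM => //; exact: measurable_funTS (@normr_measurable R _).
  - apply: measurable_funeM; apply/measurable_EFinP.
    exact: measurable_exponential_pdf.
  move=> x _; rewrite patchE; case: ifPn => [|_]; last first.
    by rewrite -EFinM lee_fin mulr_ge0 ?exponential_pdf_ge0 ?invr_ge0 ?(ltW c0).
  rewrite inE /= => x0; rewrite -EFinM lee_fin exponential_pdfE// ger0_norm//.
  by rewrite mulrA mulVf ?gt_eqF// mul1r mulNr.
rewrite ge0_integralZl//.
- by rewrite integral_exponential_pdf// mule1 ltry.
- by apply/measurable_EFinP; exact: measurable_exponential_pdf.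
- by move=> x _; rewrite lee_fin exponential_pdf_ge0// ltW.
- by rewrite lee_fin invr_ge0 ltW.
Qed.

(** This product is the function that dominates the integrand of the Laplace
transform at an interior point of the cone. *)
Lemma integral_tuple_expR_lty n (c : R) : 0 < c ->
  (\int[lebesgue_tuple R n]_t (\prod_(i < n) expR (- (c * `|tnth t i|)))%:E
    < +oo)%E.
Proof.
move=> c0.
have mf k : measurable_fun setT
    (fun t : k.-tuple R => (\prod_(i < k) expR (- (c * `|tnth t i|)))%:E).
  apply/measurable_EFinP; apply: measurable_prod => i _.
  apply: measurableT_comp => //; apply: measurableT_comp => //.
  apply: measurable_funM => //; apply: measurableT_comp => //.
  exact: measurable_tnth.
have f0 k (t : k.-tuple R) : (0 <= (\prod_(i < k) expR (- (c * `|tnth t i|)))%:E)%E.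
  by rewrite lee_fin prodr_ge0// => i _; exact: expR_ge0.
elim: n => [|n IH].
  under eq_integral do rewrite big_ord0.
  by rewrite integral_cst// mul1e; rewrite /= diracE ltry.
rewrite ge0_integral_cons//.
pose F (t : n.-tuple R) : R := \prod_(i < n) expR (- (c * `|tnth t i|)).
have E x : (\int[lebesgue_tuple R n]_t
      (\prod_(i < n.+1) expR (- (c * `|tnth (cons_pair (x, t)) i|))%R)%:E =
    (expR (- (c * `|x|)))%:E * \int[lebesgue_tuple R n]_t (F t)%:E)%E.
  have e0 : (0 <= (expR (- (c * `|x|)))%:E)%E by rewrite lee_fin expR_ge0.
  rewrite -(ge0_integralZl _ measurableT (mf n) (fun t _ => f0 n t) e0).
  apply: eq_integral => t _; rewrite -EFinM big_ord_recl /= tnth0; congr ((_ * _)%:E).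
  by apply: eq_bigr => i _; rewrite tnthS.
under eq_integral do rewrite E.
have e0 (x : R) : (0 <= (expR (- (c * `|x|)))%:E)%E by rewrite lee_fin expR_ge0.
have me : measurable_fun setT (fun x : measurableTypeR R => (expR (- (c * `|x|)))%:E).
  apply/measurable_EFinP; apply: measurableT_comp => //.
  apply: measurableT_comp => //.
  by apply: measurable_funM => //; exact: normr_measurable.
have I0 : (0 <= \int[lebesgue_tuple R n]_t (F t)%:E)%E.
  by apply: integral_ge0 => t _; exact: f0.
rewrite [ltLHS](ge0_integralZr _ measurableT me (fun x _ => e0 x) I0).
apply: lte_mul_pinfty; last exact: IH.
  by apply: integral_ge0 => x _; exact: e0.
rewrite ge0_fin_numE; first exact: integral_expR_norm_lty.
by apply: integral_ge0 => x _; exact: e0.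
Qed.

End tuple_measure.

(** * The cone of positive semidefinite matrices *)

Section sym_algebra.
Context (R : realType) (d : nat).
Implicit Types (V X Y : sym R d) (v w : 'cV[R]_d).

Lemma mx_of_symD X Y : mx_of_sym (X + Y) = mx_of_sym X + mx_of_sym Y.
Proof. exact: linearD. Qed.
Lemma mx_of_symZ a X : mx_of_sym (a *: X) = a *: mx_of_sym X.
Proof. exact: linearZ. Qed.
Lemma mx_of_symN X : mx_of_sym (- X) = - mx_of_sym X.
Proof. exact: linearN. Qed.
Lemma mx_of_sym0 : mx_of_sym (0 : sym R d) = 0.
Proof. exact: linear0. Qed.
Lemma mx_of_symBE X Y i j :
  mx_of_sym (X - Y) i j = mx_of_sym X i j - mx_of_sym Y i j.
Proof. by rewrite mx_of_symD mx_of_symN !mxE. Qed.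
Lemma mx_of_sym_tr X : (mx_of_sym X)^T = mx_of_sym X.
Proof. by apply/eqP; rewrite -mem_symv /mx_of_sym; exact: valP. Qed.
Lemma mx_of_symC X i j : mx_of_sym X i j = mx_of_sym X j i.
Proof. by rewrite -{1}mx_of_sym_tr mxE. Qed.
Lemma mx_of_sym_inj : injective (@mx_of_sym R d).
Proof. exact: val_inj. Qed.

Lemma tripC X Y : trip X Y = trip Y X.
Proof. by rewrite /trip mxtrace_mulC. Qed.
Lemma tripDl V X Y : trip (X + Y) V = trip X V + trip Y V.
Proof. by rewrite /trip mx_of_symD mulmxDl linearD. Qed.
Lemma tripZl a V X : trip (a *: X) V = a * trip X V.
Proof. by rewrite /trip mx_of_symZ -scalemxAl linearZ. Qed.
Lemma tripNl V X : trip (- X) V = - trip X V.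
Proof. by rewrite /trip mx_of_symN mulNmx linearN. Qed.
Lemma trip0l V : trip 0 V = 0.
Proof. by rewrite /trip mx_of_sym0 mul0mx linear0. Qed.
Lemma tripDr V X Y : trip V (X + Y) = trip V X + trip V Y.
Proof. by rewrite tripC tripDl !(tripC V). Qed.
Lemma tripZr a V X : trip V (a *: X) = a * trip V X.
Proof. by rewrite tripC tripZl (tripC V). Qed.
Lemma tripNr V X : trip V (- X) = - trip V X.
Proof. by rewrite tripC tripNl (tripC V). Qed.
Lemma trip0r V : trip V 0 = 0.
Proof. by rewrite tripC trip0l. Qed.
Lemma trip_suml I (r : seq I) (F : I -> sym R d) V :
  trip (\sum_(i <- r) F i) V = \sum_(i <- r) trip (F i) V.
Proof.
apply: (big_morph (fun X => trip X V)); last exact: trip0l.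
by move=> X Y; exact: tripDl.
Qed.
Lemma trip_sumr I (r : seq I) (F : I -> sym R d) V :
  trip V (\sum_(i <- r) F i) = \sum_(i <- r) trip V (F i).
Proof. by rewrite tripC trip_suml; apply: eq_bigr => i _; exact: tripC. Qed.

Lemma outer_subproof v : v *m v^T \in symv R d.
Proof. by rewrite mem_symv trmx_mul trmxK. Qed.
(** The matrices v v^T generate the cone and test membership in it: see
[psd_sum_outer] and [psdE]. *)
Definition outer v : sym R d := Subvs (outer_subproof v).

Lemma idsym_subproof : 1%:M \in symv R d.
Proof. by rewrite mem_symv trmx1. Qed.
Definition idsym : sym R d := Subvs idsym_subproof.

Lemma mx_of_outer v i j : mx_of_sym (outer v) i j = v i 0 * v j 0.
Proof. by rewrite /mx_of_sym /= mxE big_ord1 !mxE. Qed.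
Lemma mx_of_idsym : mx_of_sym idsym = 1%:M. Proof. by []. Qed.

Lemma trip_outer V v : trip V (outer v) = (v^T *m mx_of_sym V *m v) 0 0.
Proof.
by rewrite /trip /mx_of_sym /= mulmxA mxtrace_mulC mulmxA /mxtrace big_ord1.
Qed.

Lemma trip_idsym V : trip V idsym = \tr (mx_of_sym V).
Proof. by rewrite /trip mx_of_idsym mulmx1. Qed.

Lemma psdE X : psd R d X <-> forall v, 0 <= trip X (outer v).
Proof. by split=> h v; have := h v; rewrite trip_outer. Qed.

Lemma psdD X Y : psd R d X -> psd R d Y -> psd R d (X + Y).
Proof.
by move=> /psdE hX /psdE hY; apply/psdE => v; rewrite tripDl addr_ge0.
Qed.
Lemma psdZ a X : 0 <= a -> psd R d X -> psd R d (a *: X).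
Proof. by move=> a0 /psdE hX; apply/psdE => v; rewrite tripZl mulr_ge0. Qed.

Definition sqn v : R := \sum_i v i 0 ^+ 2.

Lemma trip_id_outer v : trip idsym (outer v) = sqn v.
Proof.
rewrite tripC trip_idsym /mxtrace; apply: eq_bigr => i _.
by rewrite mx_of_outer expr2.
Qed.
Lemma sqn_ge0 v : 0 <= sqn v.
Proof. by apply: sumr_ge0 => i _; exact: sqr_ge0. Qed.

Lemma psd_id : psd R d idsym.
Proof. by apply/psdE => v; rewrite trip_id_outer sqn_ge0. Qed.

Lemma trip_outer2 v w : trip (outer v) (outer w) = (\sum_i v i 0 * w i 0) ^+ 2.
Proof.
rewrite trip_outer /mx_of_sym /= mulmxA -mulmxA mxE big_ord1 expr2.
by congr (_ * _); rewrite mxE; apply: eq_bigr => i _; rewrite mxE// mulrC.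
Qed.

Lemma psd_outer v : psd R d (outer v).
Proof. by apply/psdE => w; rewrite trip_outer2 sqr_ge0. Qed.

Definition bform X v w : R := (v^T *m mx_of_sym X *m w) 0 0.

Lemma bformC X v w : bform X v w = bform X w v.
Proof.
rewrite /bform -[v^T *m _ *m w]trmxK mxE !trmx_mul trmxK mx_of_sym_tr.
by rewrite mulmxA.
Qed.

Lemma bform_delta X v k :
  bform X v (delta_mx k 0) = \sum_i v i 0 * mx_of_sym X i k.
Proof.
rewrite /bform mxE (bigD1 k)//= big1 ?addr0 => [|i ik]; last first.
  by rewrite !mxE (negbTE ik) mulr0.
rewrite [delta_mx _ _ _ _]mxE !eqxx mulr1 mxE; apply: eq_bigr => i _.
by rewrite mxE.
Qed.

Lemma bform_delta2 X j k :
  bform X (delta_mx j 0) (delta_mx k 0) = mx_of_sym X j k.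
Proof.
rewrite bform_delta (bigD1 j)//= big1 ?addr0 => [|i ij].
  by rewrite mxE !eqxx mul1r.
by rewrite mxE (negbTE ij) mul0r.
Qed.

Lemma bformDZ X v w (t : R) :
  bform X (v + t *: w) (v + t *: w) =
  bform X v v + 2 * t * bform X v w + t ^+ 2 * bform X w w.
Proof.
have -> : bform X (v + t *: w) (v + t *: w) = bform X v v + t * bform X v w +
    t * bform X w v + t * t * bform X w w.
  have tE : (v + t *: w)^T = v^T + t *: w^T by rewrite linearD linearZ.
  rewrite /bform tE !mulmxDl !mulmxDr -!scalemxAl -!scalemxAr.
  by rewrite !mxE; ring.
by rewrite (bformC X w v); ring.
Qed.

Lemma psd_diag_ge0 X i : psd R d X -> 0 <= mx_of_sym X i i.
Proof. by move=> /(_ (delta_mx i 0)); rewrite -/(bform _ _ _) bform_delta2. Qed.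

(** When X_kk = 0, the quadratic form at e_j + t e_k is affine in t, so it can be
nonnegative for all t only if its slope 2 X_jk vanishes. *)
Lemma psd_row0 X k j :
  psd R d X -> mx_of_sym X k k = 0 -> mx_of_sym X k j = 0.
Proof.
move=> hX Xkk; apply/eqP/negP => /negP Xkj.
(* at this t the quadratic form equals -1 *)
pose t := - (mx_of_sym X j j + 1) / (2 * mx_of_sym X k j).
have := hX (delta_mx j 0 + t *: delta_mx k 0); rewrite -/(bform _ _ _).
rewrite bformDZ !bform_delta2 Xkk mulr0 addr0 (mx_of_symC X j k).
rewrite (_ : 2 * t * _ = - (mx_of_sym X j j + 1)); first by lra.
by rewrite /t; field.
Qed.

(** Schur complement: subtracting the normalised k-th column squared clears row k,
and the new quadratic form at v is the minimum of the old one over v + R e_k. *)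
Lemma psd_schur X k : psd R d X -> 0 < mx_of_sym X k k ->
  exists u, psd R d (X - outer u) /\
    forall i j, mx_of_sym (X - outer u) i j =
      mx_of_sym X i j - mx_of_sym X i k * mx_of_sym X j k / mx_of_sym X k k.
Proof.
set a := mx_of_sym X k k => hX a0.
pose u : 'cV[R]_d := \col_i (mx_of_sym X i k / Num.sqrt a).
have s2 : Num.sqrt a * Num.sqrt a = a by rewrite -expr2 sqr_sqrtr// ltW.
have s0 : Num.sqrt a != 0 by rewrite gt_eqF// sqrtr_gt0.
exists u; split; last first.
  move=> i j; rewrite mx_of_symBE mx_of_outer !mxE.
  by rewrite mulf_div s2.
apply/psdE => v; rewrite tripDl tripNl.
have -> : trip (outer u) (outer v) = (bform X v (delta_mx k 0)) ^+ 2 / a.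
  have e : \sum_i u i 0 * v i 0 = bform X v (delta_mx k 0) / Num.sqrt a.
    rewrite bform_delta mulr_suml; apply: eq_bigr => i _.
    by rewrite mxE mulrC mulrA.
  by rewrite trip_outer2 e expr_div_n (expr2 (Num.sqrt a)) s2.
(* the coefficient minimises the form on v + R e_k *)
have := hX (v + (- bform X v (delta_mx k 0) / a) *: delta_mx k 0).
rewrite -/(bform _ _ _) bformDZ bform_delta2 -/a trip_outer -/(bform _ _ _).
congr (0 <= _); field; exact: lt0r_neq0.
Qed.

(** Schur elimination of the rows one after the other. This decomposition reduces the
self-duality of the cone to rank-one matrices. *)
Lemma psd_sum_outer X : psd R d X -> exists s : seq 'cV[R]_d, X = \sum_(v <- s) outer v.
Proof.
move=> hX.
have elim_rows k : (k <= d)%N -> exists s : seq 'cV[R]_d, exists Y,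
    [/\ psd R d Y, X = \sum_(v <- s) outer v + Y &
    forall i j : 'I_d, (i < k)%N -> mx_of_sym Y i j = 0].
  elim: k => [_|k IH kd]; first by exists [::], X; split=> //; rewrite big_nil add0r.
  have [s [Y [hY XE Y0]]] := IH (ltnW kd).
  pose k' := Ordinal kd.
  have := psd_diag_ge0 k' hY; rewrite le_eqVlt => /orP[/eqP Ykk|Ykk].
    exists s, Y; split=> // i j; rewrite ltnS leq_eqVlt => /orP[/eqP ik|]; last exact: Y0.
    by rewrite (_ : i = k'); [exact: psd_row0|exact: val_inj].
  have [u [hYu YuE]] := psd_schur hY Ykk.
  exists (u :: s), (Y - outer u); split => //.
    by rewrite big_cons XE (addrC Y (- _)) addrACA subrr add0r.
  move=> i j; rewrite YuE ltnS leq_eqVlt => /orP[/eqP ik|ik].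
    rewrite (_ : i = k'); last exact: val_inj.
    by rewrite mulrAC divff ?gt_eqF// mul1r (mx_of_symC Y j) subrr.
  by rewrite !(Y0 i)// !mul0r subrr.
have [s [Y [_ XE Y0]]] := elim_rows _ (leqnn d).
exists s; rewrite XE; apply/mx_of_sym_inj/matrixP => i j.
by rewrite mx_of_symD mxE Y0// addr0.
Qed.

(** The cone is self-dual: by [psd_sum_outer] it is enough to test V on rank-one
matrices. *)
Lemma trip_ge0 V X : psd R d V -> psd R d X -> 0 <= trip V X.
Proof.
move=> /psdE hV /psd_sum_outer[s ->]; rewrite trip_sumr.
by apply: sumr_ge0 => v _; exact: hV.
Qed.

(** The quadratic form is nonnegative at e_i + e_j and e_i - e_j. *)
Lemma psd_entry_le X i j : psd R d X -> `|mx_of_sym X i j| <= \tr (mx_of_sym X).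
Proof.
move=> hX.
have diag k : mx_of_sym X k k <= \tr (mx_of_sym X).
  by rewrite /mxtrace (bigD1 k)//= lerDl sumr_ge0// => l _; exact: psd_diag_ge0.
have h t : 0 <= mx_of_sym X i i + 2 * t * mx_of_sym X i j + t ^+ 2 * mx_of_sym X j j.
  by rewrite -!bform_delta2 -bformDZ; exact: hX.
have := h 1; have := h (-1); have := diag i; have := diag j.
by rewrite ler_norml; move=> ? ? ? ?; apply/andP; split; lra.
Qed.

End sym_algebra.
Arguments idsym {R d}.

(** * Topology of the space of symmetric matrices and interior of the cone *)

Section sym_topology.
Context (R : realType) (d : nat).
Implicit Types (V X Y : sym R d) (v w : 'cV[R]_d).

Lemma continuous_mx_of_sym : continuous (@mx_of_sym R d : sym R d -> 'M[R]_d).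
Proof. exact: initial_continuous. Qed.

Lemma nbhs_symP X (U : set (sym R d)) : nbhs X U <->
  exists2 e : R, 0 < e &
    forall Y, (forall i j, `|mx_of_sym Y i j - mx_of_sym X i j| < e) -> U Y.
Proof.
split=> [|[e e0 eU]].
  rewrite nbhsE => -[_ [[V oV <-] VX] VU].
  have /nbhs_ballP[e /= e0 eV] : nbhs (mx_of_sym X) V by exact: open_nbhs_nbhs.
  exists e => // Y XY; apply/VU/eV; split=> // i j.
  by rewrite /ball /= distrC; exact: XY.
have : nbhs (mx_of_sym X) (ball (mx_of_sym X) e) by exact: nbhsx_ballx.
move=> /continuous_mx_of_sym XB.
apply: (@filterS _ (nbhs X) _ (@mx_of_sym R d @^-1` ball (mx_of_sym X) e)) => // Y XY.
apply: eU => i j.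
by have [_ /(_ i j)] := XY; rewrite /ball /= distrC.
Qed.

Lemma continuous_trip V : continuous (trip V : sym R d -> R).
Proof.
move=> X.
have -> : (trip V : sym R d -> R) =
    fun Y => \sum_i \sum_j mx_of_sym V i j * mx_of_sym Y j i.
  apply/funext => Y; rewrite /trip /mxtrace; apply: eq_bigr => i _.
  by rewrite mxE.
have cont_sum n (F : 'I_n -> sym R d -> R) :
    (forall i, continuous_at (X : sym R d) (F i)) ->
    continuous_at (X : sym R d) (fun Y => \sum_(i < n) F i Y).
  move=> FX; elim: (index_enum _) => [|i s IH].
    by under eq_fun do rewrite big_nil; exact: cst_continuous.
  under eq_fun do rewrite big_cons.
  exact: (@continuousD _ _ (sym R d) (F i) _ X (FX i) IH).
apply: (cont_sum) => i; apply: (cont_sum) => j.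
apply: continuousM; first exact: cst_continuous.
apply: (@continuous_comp _ _ _ (@mx_of_sym R d) (fun M : 'M[R]_d => M j i)).
  exact: continuous_mx_of_sym.
exact: coord_continuous.
Qed.

Lemma continuous_measurable_sym (f : sym R d -> R) :
  continuous f -> measurable_fun setT f.
Proof.
move=> /continuousP cf; apply: (measurability _ (RGenOpens.measurableE R)).
move=> _ [_ [a [b ->] <-]]; rewrite setTI.
by apply: sub_sigma_algebra; apply: cf; exact: interval_open.
Qed.

Lemma measurable_trip V : measurable_fun setT (trip V : sym R d -> R).
Proof. by apply: continuous_measurable_sym; exact: continuous_trip. Qed.

Lemma closed_psd : closed (psd R d).
Proof.
have -> : psd R d = \bigcap_(v in [set: 'cV[R]_d]) (trip (outer v) @^-1` [set x | 0 <= x]).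
  apply/seteqP; split=> X.
    by move=> /psdE hX v _; rewrite /= tripC; exact: hX.
  by move=> hX; apply/psdE => v; rewrite tripC; exact: (hX v).
apply: closed_bigI => v _; apply: closed_comp; last exact: closed_ge.
by move=> X _; exact: continuous_trip.
Qed.

Lemma measurable_psd : measurable (psd R d).
Proof.
rewrite -[psd R d]setCK; apply: measurableC; apply: sub_sigma_algebra.
by apply: closed_openC; exact: closed_psd.
Qed.

Lemma open_pd : open (pd R d).
Proof. exact: open_interior. Qed.

Lemma measurable_pd : measurable (pd R d).
Proof. by apply: sub_sigma_algebra; exact: open_pd. Qed.

Lemma pd_psd X : pd R d X -> psd R d X.
Proof. exact: interior_subset. Qed.

(** The factor d comes from |v_i v_j| <= (v_i^2 + v_j^2) / 2. *)
Lemma trip_outer_le v X e : 0 <= e ->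
  (forall i j, `|mx_of_sym X i j| <= e) ->
  `|trip X (outer v)| <= e * d%:R * sqn v.
Proof.
move=> e0 he.
have -> : trip X (outer v) = \sum_i \sum_j mx_of_sym X i j * (v j 0 * v i 0).
  rewrite /trip /mxtrace; apply: eq_bigr => i _; rewrite mxE; apply: eq_bigr => j _.
  by rewrite mx_of_outer.
apply: (le_trans (ler_norm_sum _ _ _)).
apply: (@le_trans _ _ (\sum_i \sum_j e * ((v i 0 ^+ 2 + v j 0 ^+ 2) / 2))).
  apply: ler_sum => i _; apply: (le_trans (ler_norm_sum _ _ _)).
  apply: ler_sum => j _; rewrite normrM; apply: ler_pM => //.
  have := sqr_ge0 (v i 0 + v j 0); have := sqr_ge0 (v i 0 - v j 0).
  move: (v i 0) (v j 0) => a b h1 h2.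
  by rewrite ler_norml; apply/andP; split; nra.
have -> : \sum_i \sum_j e * ((v i 0 ^+ 2 + v j 0 ^+ 2) / 2) =
   e * (\sum_i \sum_(j < d) (v i 0 ^+ 2) / 2 + \sum_(i < d) \sum_j (v j 0 ^+ 2) / 2).
  rewrite -big_split /= mulr_sumr; apply: eq_bigr => i _.
  by rewrite -big_split /= mulr_sumr; apply: eq_bigr => j _; rewrite mulrDl.
rewrite (exchange_big _ _ _ _ _ (fun i j => v j 0 ^+ 2 / 2)) /=.
have -> : \sum_i \sum_(j < d) (v i 0 ^+ 2) / 2 = d%:R * sqn v / 2.
  rewrite /sqn mulr_sumr mulr_suml; apply: eq_bigr => i _.
  by rewrite sumr_const card_ord mulr_natl mulrnAl.
by rewrite -splitr mulrA.
Qed.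

(** Topological interior and uniform positive definiteness coincide. The second form
is the one used in estimates. *)
Lemma pdP X : pd R d X <-> exists2 c : R, 0 < c & psd R d (X - c *: idsym).
Proof.
split=> [/nbhs_symP[e e0 eX]|[c c0 hX]].
  (* half of e, since the neighbourhood is defined by strict inequalities *)
  exists (e / 2); first by rewrite divr_gt0.
  apply: eX => i j; rewrite mx_of_symBE addrAC subrr add0r normrN.
  rewrite mx_of_symZ mx_of_idsym !mxE normrM gtr0_norm ?divr_gt0//.
  apply: (@le_lt_trans _ _ (e / 2 * 1)); last by lra.
  by apply: ler_wpM2l; [lra|case: (_ == _); rewrite ?normr1// normr0].
apply/nbhs_symP; exists (c / d.+1%:R); first by rewrite divr_gt0.
move=> Y XY; apply/psdE => v.
have /psdE/(_ v) := hX; rewrite tripDl tripNl tripZl trip_id_outer => hXv.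
have : `|trip (Y - X) (outer v)| <= c / d.+1%:R * d%:R * sqn v.
  by apply: trip_outer_le => [|i j]; rewrite ?mx_of_symBE ltW// divr_gt0.
have : c / d.+1%:R * d%:R * sqn v <= c * sqn v.
  rewrite ler_wpM2r ?sqn_ge0// mulrAC ler_pdivrMr//.
  by rewrite ler_wpM2l ?(ltW c0)// ler_nat.
rewrite tripDl tripNl ler_norml => h1 /andP[h2 _].
move: h1 h2 hXv; move: (c / _ * _ * _) (c * sqn v) => K L; lra.
Qed.

(** The linear form <V, .> controls the trace on the cone, and with it all entries. *)
Lemma pd_trip_ge V X c : psd R d (V - c *: idsym) -> psd R d X ->
  c * \tr (mx_of_sym X) <= trip V X.
Proof.
move=> hV hX; have := trip_ge0 hV hX.
by rewrite tripDl tripNl tripZl (tripC idsym) trip_idsym subr_ge0.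
Qed.

Lemma pdD X Y : pd R d X -> psd R d Y -> pd R d (X + Y).
Proof.
move=> /pdP[c c0 hX] hY; apply/pdP; exists c; first exact: c0.
by rewrite addrAC; exact: psdD.
Qed.
Lemma pdZ a X : 0 < a -> pd R d X -> pd R d (a *: X).
Proof.
move=> a0 /pdP[c c0 hX]; apply/pdP; exists (a * c); first exact: mulr_gt0.
by rewrite -scalerA -scalerBr; apply: psdZ => //; exact: ltW.
Qed.
Lemma pd_id a : 0 < a -> pd R d (a *: idsym).
Proof.
move=> a0; apply: pdZ => //; apply/pdP; exists 1 => //.
by rewrite scale1r subrr; apply/psdE => v; rewrite trip0l.
Qed.
End sym_topology.

(** * Lebesgue measure on symmetric matrices and finiteness of the Laplace transform *)

Section lebesgue_sym_theory.
Context (R : realType) (d : nat).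
Implicit Types (V X Y W : sym R d) (v w : 'cV[R]_d).
Local Notation leb := (@lebesgue_sym R d).
Local Notation n := #|upper d|.
Local Notation soc := (@sym_of_coord R d).

Definition coord_sym X : n.-tuple R :=
  [tuple trip X (basis_sym R (enum_val k)) | k < n].

Lemma coord_symK : cancel soc coord_sym.
Proof.
move=> t; apply: eq_from_tnth => k; rewrite tnth_mktuple /sym_of_coord.
rewrite trip_suml (bigD1 k)//= big1 ?addr0 => [|l lk].
  by rewrite tripZl trip_basis_sym ?enum_valP// eqxx mulr1.
rewrite tripZl trip_basis_sym ?enum_valP//.
by rewrite (inj_eq enum_val_inj) (negbTE lk) mulr0.
Qed.

Lemma trip_basis X (ij : 'I_d * 'I_d) : trip X (basis_sym R ij) =
  if ij.1 == ij.2 then mx_of_sym X ij.1 ij.1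
  else Num.sqrt 2 * mx_of_sym X ij.1 ij.2.
Proof.
case: ij => i j /=.
have tr_delta k l : \tr (mx_of_sym X *m delta_mx k l) = mx_of_sym X l k.
  rewrite /mxtrace (bigD1 l)//= big1 ?addr0 => [|a al].
    rewrite mxE (bigD1 k)//= big1 ?addr0 => [|b bk].
      by rewrite mxE !eqxx mulr1.
    by rewrite mxE (negbTE bk) mulr0.
  by rewrite mxE big1// => b _; rewrite mxE (negbTE al) andbF mulr0.
rewrite /trip {2}/mx_of_sym /= /basis_mx /=; case: eqVneq => [ij|ij].
  by rewrite tr_delta.
rewrite -scalemxAr mxtraceZ mulmxDr mxtraceD !tr_delta (mx_of_symC X j i).
rewrite -mulr2n -(mulr_natl (mx_of_sym X i j)) mulrA; congr (_ * _).
by rewrite -{2}(@sqr_sqrtr R 2)// expr2 mulrA mulVf ?mul1r// gt_eqF// sqrtr_gt0.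
Qed.

(** Up to the factor sqrt 2, the coordinates in the basis are the entries on and
above the diagonal. *)
Lemma sym_eq0 X :
  (forall ij, ij \in upper d -> trip X (basis_sym R ij) = 0) -> X = 0.
Proof.
move=> X0.
have Xle (i j : 'I_d) : (i <= j)%N -> mx_of_sym X i j = 0.
  move=> ij; have := X0 (i, j); rewrite inE trip_basis /= => /(_ ij).
  case: eqVneq => [->//|_ /eqP].
  by rewrite mulf_eq0 gt_eqF ?sqrtr_gt0//= => /eqP.
apply/mx_of_sym_inj/matrixP => i j; rewrite mx_of_sym0 mxE.
have [/Xle//|/ltnW/Xle] := leqP i j.
by rewrite mx_of_symC.
Qed.

Lemma sym_of_coordK : cancel coord_sym soc.
Proof.
move=> X; apply/eqP; rewrite -subr_eq0; apply/eqP/sym_eq0 => ij ijd.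
have := coord_symK (coord_sym X).
move=> /(congr1 (fun t => tnth t (enum_rank_in ijd ij))).
rewrite !tnth_mktuple enum_rankK_in// => h.
by rewrite tripDl tripNl h subrr.
Qed.

Lemma sym_of_coordD s t : soc (addt s t) = soc s + soc t.
Proof.
rewrite /sym_of_coord -big_split /=; apply: eq_bigr => k _.
by rewrite tnth_mktuple scalerDl.
Qed.

Lemma ge0_integral_sym (f : sym R d -> \bar R) :
  measurable_fun setT f -> (forall X, 0 <= f X)%E ->
  (\int[leb]_X f X = \int[lebesgue_tuple R n]_t f (soc t))%E.
Proof.
move=> mf f0.
transitivity (\int[pushforward (lebesgue_tuple R n) soc]_X f X)%E => //.
rewrite ge0_integral_pushforward//; last exact: measurable_sym_of_coord.
Qed.

(** Translations are homeomorphisms. *)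
Lemma measurable_symD W : measurable_fun setT (fun X : sym R d => X + W).
Proof.
apply: (@measurability _ _ _ _ _ _ (@open (sym R d))) => // _ [V oV <-].
suff oW : open ((fun X : sym R d => X + W) @^-1` V).
  by rewrite setTI; exact: sub_sigma_algebra.
rewrite openE => X /= VX.
have /nbhs_symP[e e0 eV] : nbhs (X + W) V by exact: open_nbhs_nbhs.
apply/nbhs_symP; exists e => // Y XY; apply: eV => i j.
have := XY i j; rewrite -!mx_of_symBE; congr (`|mx_of_sym _ _ _| < _).
by rewrite [in RHS]opprD addrACA subrr addr0.
Qed.

(** Coordinates are additive, so this is translation invariance on tuples. *)
Lemma ge0_integral_symD W (f : sym R d -> \bar R) :
  measurable_fun setT f -> (forall X, 0 <= f X)%E ->
  (\int[leb]_X f (X + W)%R = \int[leb]_X f X)%E.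
Proof.
move=> mf f0.
rewrite ge0_integral_sym//; last exact: (measurableT_comp mf (measurable_symD W)).
have mfs : measurable_fun setT (f \o soc).
  by apply: measurableT_comp => //; exact: measurable_sym_of_coord.
rewrite [RHS]ge0_integral_sym//.
rewrite -[RHS](ge0_integral_addt (coord_sym W) mfs); last by move=> t; exact: f0.
by apply: eq_integral => t _ /=; rewrite sym_of_coordD sym_of_coordK.
Qed.

(** Off-diagonal entries are coordinates divided by sqrt 2, hence smaller. *)
Lemma sym_of_coord_entry_le (t : n.-tuple R) i j :
  forall e, (forall k, `|tnth t k| <= e) -> `|mx_of_sym (soc t) i j| <= e.
Proof.
move=> e te.
have le (a b : 'I_d) : (a <= b)%N -> `|mx_of_sym (soc t) a b| <= e.
  move=> ab; have abd : (a, b) \in upper d by rewrite inE.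
  have := te (enum_rank_in abd (a, b)); rewrite -{1}(coord_symK t) tnth_mktuple.
  rewrite enum_rankK_in// trip_basis /=; case: eqVneq => [->//|_].
  apply: le_trans; rewrite normrM ler_peMl// ger0_norm ?sqrtr_ge0//.
  by rewrite -[leLHS]sqrtr1 ler_sqrt// ler1n.
have [|/ltnW] := leqP i j; first exact: le.
by rewrite mx_of_symC; exact: le.
Qed.

Lemma lebesgue_sym_open_gt0 (U : set (sym R d)) X :
  open U -> U X -> (0 < leb U)%E.
Proof.
move=> oU UX.
have /nbhs_symP[e e0 eU] : nbhs X U by exact: open_nbhs_nbhs.
have e20 : 0 < e / 2 by rewrite divr_gt0.
apply: (lt_le_trans (lebesgue_tuple_box_gt0 (coord_sym X) e20)).
rewrite /lebesgue_sym /pushforward.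
have mU : measurable (soc @^-1` U).
  rewrite -[X in measurable X]setTI; apply: measurable_sym_of_coord => //.
  exact: sub_sigma_algebra.
have boxU : [set t | forall i, `|tnth t i - tnth (coord_sym X) i| < e / 2]
    `<=` soc @^-1` U.
  move=> t /= tX; apply: eU => i j; rewrite -mx_of_symBE.
  apply: (@le_lt_trans _ _ (e / 2)); last by lra.
  pose s := [tuple tnth t k - tnth (coord_sym X) k | k < n].
  have -> : soc t - X = soc s.
    rewrite -{1}(sym_of_coordK X) /sym_of_coord -sumrB; apply: eq_bigr => k _.
    by rewrite [tnth s k]tnth_mktuple scalerBl.
  by apply: sym_of_coord_entry_le => k; rewrite tnth_mktuple ltW.
apply: le_measure => //; rewrite inE//.
rewrite (_ : [set t | _] = \bigcap_(i in [set: 'I_n])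
    ((fun t => tnth t i) @^-1` ball (tnth (coord_sym X) i) (e / 2))).
  apply: fin_bigcap_measurable => // i _; rewrite -[X in measurable X]setTI.
  by apply: measurable_tnth => //; exact: measurable_ball.
apply/seteqP; split=> t h i; last by have := h i I; rewrite /ball/= distrC.
by move=> _; rewrite /= /ball/= distrC; exact: h.
Qed.

Lemma measurable_fun_expR_trip D V :
  measurable_fun D (fun X : sym R d => (expR (- trip V X))%:E).
Proof.
apply: measurable_funTS; apply/measurable_EFinP; apply: measurableT_comp => //.
by apply: measurableT_comp => //; exact: measurable_trip.
Qed.

Lemma laplace_ge0 V : (0 <= laplace V)%E.
Proof. by apply: integral_ge0 => X _; rewrite lee_fin expR_ge0. Qed.

(** On the cone <V, X> >= c tr X, and tr X dominates every coordinate of X up to a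
factor 2, so the integrand is below a product of one-dimensional exponentials. *)
Lemma laplace_lty V : pd R d V -> (laplace V < +oo)%E.
Proof.
move=> /pdP[c c0 hV].
pose g : sym R d -> \bar R := (fun X => (expR (- trip V X))%:E) \_ (psd R d).
have mg : measurable_fun setT g.
  apply/(measurable_restrictT _ _).1; first exact: measurable_psd.
  exact: measurable_fun_expR_trip.
have g0 X : (0 <= g X)%E by apply: erestrict_ge0 => y _; rewrite lee_fin expR_ge0.
rewrite /laplace integral_mkcond -/g ge0_integral_sym//.
(* each of the n coordinates is at most 2 tr X; n.+1 since n may be 0 *)
pose c' := c / (2 * n.+1%:R).
have c'0 : 0 < c' by rewrite divr_gt0// mulr_gt0.
apply: le_lt_trans (integral_tuple_expR_lty n c'0).
apply: ge0_le_integral => //.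
- by apply: measurableT_comp => //; exact: measurable_sym_of_coord.
- apply/measurable_EFinP; apply: measurable_prod => i _.
  apply: measurableT_comp => //; apply: measurableT_comp => //.
  apply: measurable_funM => //; apply: measurableT_comp => //.
  exact: measurable_tnth.
move=> t _; rewrite /g patchE; case: ifPn => [|_]; last first.
  by rewrite lee_fin prodr_ge0// => i _; exact: expR_ge0.
rewrite inE => ht; rewrite lee_fin -expR_sum ler_expR sumrN lerN2.
set X := soc t in ht *.
have := pd_trip_ge hV ht; apply: le_trans.
have tle k : `|tnth t k| <= 2 * \tr (mx_of_sym X).
  rewrite -{1}(coord_symK t) tnth_mktuple trip_basis -/X.
  case: ifPn => _.
    have := psd_entry_le (enum_val k).1 (enum_val k).1 ht.
    have : 0 <= \tr (mx_of_sym X) by apply: sumr_ge0 => i _; exact: psd_diag_ge0.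
    lra.
  rewrite normrM; apply: ler_pM => //; last exact: psd_entry_le.
  rewrite ger0_norm ?sqrtr_ge0// -[leRHS](@ger0_norm R 2)// -sqrtr_sqr.
  by apply: ler_wsqrtr; lra.
apply: (@le_trans _ _ (\sum_(k < n) c' * (2 * \tr (mx_of_sym X)))).
  by apply: ler_sum => k _; rewrite ler_wpM2l// ltW.
rewrite sumr_const card_ord -[leLHS]mulr_natl /c'.
have tr0 : 0 <= \tr (mx_of_sym X) by apply: sumr_ge0 => i _; exact: psd_diag_ge0.
have -> : n%:R * (c / (2 * n.+1%:R) * (2 * \tr (mx_of_sym X))) =
   (n%:R / n.+1%:R) * (c * \tr (mx_of_sym X)).
  have: n.+1%:R != 0 :> R by rewrite pnatr_eq0.
  by move: (n.+1%:R : R) (n%:R : R) => N M N0; field.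
by rewrite ler_piMl ?mulr_ge0 ?(ltW c0)// ler_pdivrMr// mul1r ler_nat.
Qed.

End lebesgue_sym_theory.

(** * The Laplace transform of the cone *)

Section laplace_theory.
Context (R : realType) (d : nat).
Implicit Types (V X Y W : sym R d) (v w : 'cV[R]_d) (B U : set (sym R d)).
Local Notation leb := (@lebesgue_sym R d).

Lemma open_trip_lt V a : open [set X | trip V X < a].
Proof.
have /continuousP h := @continuous_trip R d V.
exact: (h [set x | x < a] (@open_lt R a)).
Qed.

Lemma integral_expR_ge B V a : measurable B -> (forall X, B X -> trip V X <= a) ->
  ((expR (- a))%:E * leb B <= \int[leb]_(X in B) (expR (- trip V X))%:E)%E.
Proof.
move=> mB hB; rewrite -integral_cst//; apply: ge0_le_integral => //.
- by move=> X _; rewrite lee_fin expR_ge0.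
- exact: measurable_fun_expR_trip.
- by move=> X BX; rewrite lee_fin ler_expR lerN2 hB.
Qed.

(** Near X0 the exponential is bounded below, and open sets are not null. *)
Lemma integral_expR_gt0 B U X0 V : measurable B -> open U -> U X0 -> U `<=` B ->
  (0 < \int[leb]_(X in B) (expR (- trip V X))%:E)%E.
Proof.
move=> mB oU UX0 UB.
(* cut U down so that the exponential is bounded below on it *)
pose T := U `&` trip V @^-1` [set x | x < trip V X0 + 1].
have oT : open T.
  by apply: openI => //; exact: open_trip_lt.
have mT : measurable T by exact: sub_sigma_algebra.
have TX0 : T X0 by split=> //=; rewrite ltrDl.
apply: (@lt_le_trans _ _ (\int[leb]_(X in T) (expR (- trip V X))%:E)%E).
  have : (forall X, T X -> trip V X <= trip V X0 + 1) by move=> X [_ /ltW].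
  move=> /(integral_expR_ge mT); apply: lt_le_trans.
  by rewrite mule_gt0 ?lte_fin ?expR_gt0//; exact: lebesgue_sym_open_gt0 TX0.
apply: ge0_subset_integral => //; first exact: measurable_fun_expR_trip.
by move=> X [/UB].
Qed.

(** The trace bound 1 is what separates this matrix from v v^T + K for unit v in
[laplace_lty_pd]. *)
Lemma pd_small : exists X : sym R d, pd R d X /\ \tr (mx_of_sym X) < 1.
Proof.
exists (d.+1%:R^-1 *: idsym); split; first by apply: pd_id; rewrite invr_gt0.
rewrite mx_of_symZ mxtraceZ mx_of_idsym mxtrace1 mulrC ltr_pdivrMr// mul1r.
by rewrite ltr_nat.
Qed.

Lemma laplace_gt0 V : (0 < laplace V)%E.
Proof.
have [X [pX _]] := pd_small.
exact: (integral_expR_gt0 V (@measurable_psd R d) (@open_pd R d) pX (@pd_psd R d)).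
Qed.

(** Substitute X + W for X. *)
Lemma laplace_shift V W :
  (\int[leb]_(X in [set X | psd R d (X - W)%R]) (expR (- trip V X))%:E =
    (expR (- trip V W))%:E * laplace V)%E.
Proof.
pose g : sym R d -> \bar R := (fun X => (expR (- trip V X))%:E) \_ (psd R d).
have mg : measurable_fun setT g.
  apply/(measurable_restrictT _ _).1; first exact: measurable_psd.
  exact: measurable_fun_expR_trip.
have g0 X : (0 <= g X)%E by apply: erestrict_ge0 => y _; rewrite lee_fin expR_ge0.
have e0 : (0 <= (expR (- trip V W))%:E :> \bar R)%E by rewrite lee_fin expR_ge0.
rewrite /laplace [in RHS]integral_mkcond -/g -(ge0_integral_symD (- W))//.
rewrite -ge0_integralZl//; last exact: measurableT_comp mg (measurable_symD (- W)).
rewrite [LHS]integral_mkcond; apply: eq_integral => X _.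
rewrite /g !patchE; have [h|h] := boolP (X - W \in psd R d).
  rewrite ifT; last by rewrite !inE in h *.
  by rewrite -EFinM -expRD tripDr tripNr; congr ((expR _)%:E); ring.
by rewrite ifF ?mule0//; apply/negbTE; move: h; rewrite !notin_setE.
Qed.

Lemma measurable_psd_shift W : measurable [set X : sym R d | psd R d (X - W)].
Proof.
by rewrite -[X in measurable X]setTI; apply: (measurable_symD (- W)) => //;
  exact: measurable_psd.
Qed.

(** For a unit vector v, the cone contains v v^T + K and, disjoint from it, the
matrices of K of trace less than 1.  If the integrals of exp(-<V, .>) over K and
over the second set are z and b, [laplace_shift] gives z >= exp(-v^T V v) z + b,
hence v^T V v >= b / z: a bound that is uniform in v. *)
Lemma laplace_lty_pd V : (laplace V < +oo)%E -> pd R d V.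
Proof.
move=> Voo.
have Vfin : laplace V \is a fin_num by rewrite ge0_fin_numE ?laplace_ge0.
set z := fine (laplace V).
have zE : laplace V = z%:E by rewrite fineK.
have z0 : 0 < z by rewrite -lte_fin -zE laplace_gt0.
pose T := [set X : sym R d | trip idsym X < 1].
have oT : open T.
  exact: open_trip_lt.
pose B := psd R d `&` T.
have mB : measurable B.
  by apply: measurableI; [exact: measurable_psd|exact: sub_sigma_algebra].
have [X0 [X0pd]] := pd_small; rewrite -trip_idsym tripC => X0T.
pose b := (\int[leb]_(X in B) (expR (- trip V X))%:E)%E.
have b0 : (0 < b)%E.
  apply: (@integral_expR_gt0 _ (pd R d `&` T) X0) => //.
    by apply: openI => //; exact: open_pd.
  by move=> X [/pd_psd].
have mf D := @measurable_fun_expR_trip R d D V.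
have f0 X : (0 <= (expR (- trip V X))%:E :> \bar R)%E by rewrite lee_fin expR_ge0.
have bz : (b <= laplace V)%E.
  by apply: ge0_subset_integral => //; [exact: measurable_psd|move=> X []].
have bE : b = (fine b)%:E.
  by rewrite fineK// ge0_fin_numE ?(le_lt_trans bz)// ltW.
have fb0 : 0 < fine b by rewrite -lte_fin -bE.
have key v : sqn v = 1 -> fine b / z <= trip V (outer v).
  move=> v1; pose S := [set X | psd R d (X - outer v)].
  have SB : [disjoint S & B].
    apply/eqP; rewrite -subset0 => X [/= hS [_]]; rewrite /T/= => /lt_geF.
    have := trip_ge0 (@psd_id R d) hS; rewrite tripDr tripNr trip_id_outer v1.
    by rewrite subr_ge0 => ->.
  have SBK : S `|` B `<=` psd R d.
    move=> X [/= hS|[]//]; rewrite -(subrK (outer v) X).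
    by apply: psdD => //; exact: psd_outer.
  have mS : measurable S by exact: measurable_psd_shift.
  have : (\int[leb]_(X in S `|` B) (expR (- trip V X))%:E <= laplace V)%E.
    apply: ge0_subset_integral => //; first exact: measurableU.
    exact: measurable_psd.
  rewrite ge0_integral_setU// laplace_shift -/b bE zE -EFinM -EFinD lee_fin.
  have := expR_ge1Dx (- trip V (outer v)).
  move: (trip V (outer v)) (expR _) => q E h1 h2.
  rewrite ler_pdivrMr//; nra.
apply/pdP; exists (fine b / z); first exact: divr_gt0.
apply/psdE => v; rewrite tripDl tripNl tripZl trip_id_outer subr_ge0.
have := sqn_ge0 v; rewrite le_eqVlt => /orP[/eqP v0|v0].
  rewrite -v0 mulr0 (_ : outer v = 0) ?trip0r//.
  apply/mx_of_sym_inj/matrixP => i j; rewrite mx_of_outer mx_of_sym0 mxE.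
  suff -> : v i 0 = 0 by rewrite mul0r.
  apply/eqP; rewrite -sqrf_eq0; apply/eqP.
  by move/esym/eqP : v0; rewrite psumr_eq0 => [/allP/(_ i)|k _];
    [rewrite mem_index_enum => /(_ isT)/eqP|exact: sqr_ge0].
pose s := Num.sqrt (sqn v).
have s0 : 0 < s by rewrite sqrtr_gt0.
have sq : sqn v = s ^+ 2 by rewrite sqr_sqrtr// ltW.
have := key (s^-1 *: v).
have -> : sqn (s^-1 *: v) = 1.
  rewrite /sqn; under eq_bigr do rewrite mxE exprMn.
  by rewrite -mulr_sumr -/(sqn v) sq exprVn mulVf// expf_neq0// gt_eqF.
have -> : outer (s^-1 *: v) = (s^-1 ^+ 2) *: outer v.
  apply/mx_of_sym_inj/matrixP => i j; rewrite mx_of_outer mx_of_symZ [RHS]mxE.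
  by rewrite mx_of_outer !mxE; ring.
move=> /(_ erefl); rewrite tripZr sq exprVn.
by rewrite [leRHS]mulrC ler_pdivlMr// exprn_gt0.
Qed.

(** For t > 0, t I + K lies in int K, and the integral over it is
exp(-t tr V) Z(V), which tends to Z(V) with t. *)
Lemma laplace_pd V : (laplace V < +oo)%E ->
  (\int[leb]_(X in pd R d) (expR (- trip V X))%:E = laplace V)%E.
Proof.
move=> Voo.
have mf D := @measurable_fun_expR_trip R d D V.
have f0 X : (0 <= (expR (- trip V X))%:E :> \bar R)%E by rewrite lee_fin expR_ge0.
apply/eqP; rewrite eq_le; apply/andP; split.
  apply: ge0_subset_integral => //; first exact: measurable_pd.
    exact: measurable_psd.
  exact: pd_psd.
have Vfin : laplace V \is a fin_num by rewrite ge0_fin_numE ?laplace_ge0.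
set z := fine (laplace V).
have zE : laplace V = z%:E by rewrite fineK.
have z0 : 0 < z by rewrite -lte_fin -zE laplace_gt0.
have ht t : 0 < t -> ((expR (- (t * trip V idsym)) * z)%:E <=
    \int[leb]_(X in pd R d) (expR (- trip V X))%:E)%E.
  move=> t0; rewrite EFinM -zE -tripZr -laplace_shift.
  apply: ge0_subset_integral => //; first exact: measurable_psd_shift.
    exact: measurable_pd.
  by move=> X /= hX; apply/pdP; exists t.
rewrite zE; apply/lee_addgt0Pr => e e0.
set a := trip V idsym in ht.
have a0 : 0 < `|a| + 1 by rewrite ltr_wpDl.
(* by exp(-t a) >= 1 - t a, the loss z (1 - exp(-t a)) is then at most e *)
pose t := e / (z * (`|a| + 1)).
have t0 : 0 < t by rewrite divr_gt0// mulr_gt0.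
apply: (@le_trans _ _ ((expR (- (t * a)) * z)%:E + e%:E)%E); last first.
  by apply: leeD => //; exact: ht.
rewrite -EFinD lee_fin.
have tz : t * z * (`|a| + 1) = e.
  by rewrite /t; move: (`|a| + 1) a0 => b b0; field; rewrite !gt_eqF.
have := expR_ge1Dx (- (t * a)); have := ler_norm a.
have : 0 < t * z by rewrite mulr_gt0.
move: tz; move: (expR _) => E; move: (`|a|) => b tz tz0 ab hE.
have : (1 - t * a) * z <= E * z by rewrite ler_pM2r//.
have : t * z * a <= t * z * b by rewrite ler_pM2l.
nra.
Qed.

(** The integrand is positive everywhere. *)
Lemma integral_expR_eq0 V B : measurable B ->
  (\int[leb]_(X in B) (expR (- trip V X))%:E = 0)%E -> leb B = 0%E.
Proof.
move=> mB intB; apply: measure_negligible => //.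
have mf := @measurable_fun_expR_trip R d B V.
have /(ae_eq_integral_abs _ mB mf) :
    (\int[leb]_(X in B) `|(expR (- trip V X))%:E| = 0)%E.
  rewrite -[RHS]intB; apply: eq_integral => X _.
  by rewrite gee0_abs// lee_fin expR_ge0.
apply: negligibleS => X NX /= /(_ NX) /eqP.
by rewrite eqe gt_eqF// expR_gt0.
Qed.

(** By [laplace_pd] the boundary contributes nothing to a finite integral of a
positive function. *)
Lemma psd_setD_pd_null : leb (psd R d `\` pd R d) = 0%E.
Proof.
set N := _ `\` _.
have mN : measurable N by apply: measurableD; [exact: measurable_psd|exact: measurable_pd].
have Ioo : (laplace (idsym : sym R d) < +oo)%E.
  by apply: laplace_lty; rewrite -(scale1r idsym); exact: pd_id.
have mf D := @measurable_fun_expR_trip R d D idsym.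
have f0 X : (0 <= (expR (- trip idsym X))%:E :> \bar R)%E by rewrite lee_fin expR_ge0.
have IE := laplace_pd Ioo.
have intN : (\int[leb]_(X in N) (expR (- trip idsym X))%:E = 0)%E.
  have disj : [disjoint pd R d & N] by apply/eqP; rewrite -subset0 => X [? []].
  have := ge0_integral_setU leb (@measurable_pd R d) mN (mf _) (fun X _ => f0 X) disj.
  rewrite setDUK; last exact: pd_psd.
  rewrite -[LHS]/(laplace idsym).
  have : laplace (idsym : sym R d) \is a fin_num.
    by rewrite ge0_fin_numE ?laplace_ge0.
  rewrite IE; move: (laplace idsym) (\int[leb]_(X in N) _)%E.
  move=> [l||]// [s||]//= _ [] /eqP.
  by rewrite addrC -subr_eq subrr eq_sym => /eqP ->.
exact: integral_expR_eq0 mN intN.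
Qed.

Lemma ge0_integral_psd_pd (f : sym R d -> \bar R) :
  measurable_fun setT f -> (forall X, 0 <= f X)%E ->
  (\int[leb]_(X in psd R d) f X = \int[leb]_(X in pd R d) f X)%E.
Proof.
move=> mf f0.
rewrite (@ge0_negligible_integral _ _ _ _ _ (psd R d `\` pd R d))//.
- by rewrite setDD setIidr//; exact: pd_psd.
- by apply: measurableD; [exact: measurable_psd|exact: measurable_pd].
- exact: measurable_psd.
- exact: measurable_funTS.
- exact: psd_setD_pd_null.
Qed.

Lemma laplaceE V : laplace V = (\int[leb]_(X in pd R d) (expR (- trip V X))%:E)%E.
Proof.
apply: ge0_integral_psd_pd; first exact: measurable_fun_expR_trip.
by move=> X; rewrite lee_fin expR_ge0.
Qed.

End laplace_theory.

(** * Measures given by a density *)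

Section density.
Context d (T : measurableType d) (R : realType) (mu : {measure set T -> \bar R}).
Variables (D : set T) (mD : measurable D) (q : T -> R).
Hypothesis mq : measurable_fun D q.
Hypothesis q0 : forall x, D x -> 0 <= q x.

Definition density_measure (B : set T) : \bar R :=
  (\int[mu]_(x in B `&` D) (q x)%:E)%E.

Let density0 : density_measure set0 = 0%E.
Proof. by rewrite /density_measure set0I integral_set0. Qed.

Let density_ge0 B : (0 <= density_measure B)%E.
Proof. by apply: integral_ge0 => x [_ /q0]; rewrite lee_fin. Qed.

Let density_sigma_additive : semi_sigma_additive density_measure.
Proof.
move=> F mF tF mUF; rewrite /density_measure setI_bigcupl.
have mFD k : measurable (F k `&` D) by exact: measurableI.
rewrite ge0_integral_bigcup//.
- apply: is_cvg_ereal_nneg_natsum_cond => n _ _.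
  by apply: integral_ge0 => x [_ /q0]; rewrite lee_fin.
- apply/measurable_EFinP; apply: measurable_funS mq => //.
  by rewrite -setI_bigcupl; exact: subIsetr.
- by move=> x [k _ [_ /q0]]; rewrite lee_fin.
- exact: trivIset_setIr.
Qed.

HB.instance Definition _ := isMeasure.Build _ _ _ density_measure
  density0 density_ge0 density_sigma_additive.

Hypothesis intq : (\int[mu]_(x in D) (q x)%:E = 1)%E.

Let density_setT : density_measure setT = 1%E.
Proof. by rewrite /density_measure setTI. Qed.

HB.instance Definition _ :=
  @Measure_isProbability.Build _ _ R density_measure density_setT.

Lemma density_probability : exists Q : probability T R,
  forall B, Q B = (\int[mu]_(x in B `&` D) (q x)%:E)%E.
Proof. by exists [the probability T R of density_measure]. Qed.

End density.

Section density_integral.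
Context d (T : measurableType d) (R : realType).
Variables (mu Q : {measure set T -> \bar R}).
Variables (D : set T) (mD : measurable D) (q : T -> R).
Hypothesis mq : measurable_fun D q.
Hypothesis q0 : forall x, D x -> 0 <= q x.
Hypothesis QE : forall B, measurable B ->
  Q B = (\int[mu]_(x in B `&` D) (q x)%:E)%E.

Let g := (EFin \o q) \_ D.
Let mg : measurable_fun setT g.
Proof. by apply/(measurable_restrictT _ _).1 => //; exact/measurable_EFinP. Qed.
Let g0 x : (0 <= g x)%E.
Proof. by apply: erestrict_ge0 => y /q0; rewrite lee_fin. Qed.

Import HBNNSimple.

Let integral_nnsfun_density (h : {nnsfun T >-> R}) :
  (\int[Q]_x (h x)%:E = \int[mu]_x ((h x)%:E * g x))%E.
Proof.
have hE x : ((h x)%:E * g x =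
    \sum_(y \in range h) (y * \1_(h @^-1` [set y]) x)%:E * g x)%E.
  rewrite -ge0_mule_fsuml => [|y]; last exact: nnfun_muleindic_ge0.
  by rewrite fsumEFin// -fimfunE.
under [RHS]eq_integral do rewrite hE.
have mI y : measurable_fun setT (fun x => (y * \1_(h @^-1` [set y]) x)%:E).
  by apply/measurable_EFinP; exact: measurable_funM.
rewrite ge0_integral_fsum//; first last.
- by move=> y x _; rewrite mule_ge0// nnfun_muleindic_ge0.
- by move=> y; exact: emeasurable_funM.
rewrite integralT_nnsfun sintegralE; apply: eq_fsbigr => y /[!inE] yh.
have y0 : (0 <= y%:E)%E by move: yh => [x _ <-]; rewrite lee_fin.
under [RHS]eq_integral do rewrite EFinM -muleA.
rewrite ge0_integralZl//; first last.
- by move=> x _; rewrite mule_ge0// lee_fin.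
- by apply: emeasurable_funM => //; exact/measurable_EFinP.
congr (_ * _)%E; rewrite QE// [LHS]integral_mkcond.
apply: eq_integral => x _; rewrite /g /patch in_setI indicE.
by case: (x \in h @^-1` [set y]) => /=; rewrite ?mul1e ?mul0e.
Qed.

Lemma ge0_integral_density (f : T -> \bar R) :
  measurable_fun D f -> (forall x, D x -> 0 <= f x)%E ->
  (\int[Q]_(x in D) f x = \int[mu]_(x in D) (f x * (q x)%:E))%E.
Proof.
move=> mf f0; pose F := f \_ D.
have mF : measurable_fun setT F by exact/(measurable_restrictT _ _).1.
have F0 x : (0 <= F x)%E by exact: erestrict_ge0.
transitivity (\int[mu]_x (F x * g x))%E; last first.
  rewrite [RHS]integral_mkcond; apply: eq_integral => x _.
  by rewrite /F /g /patch; case: ifP; rewrite ?mul0e.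
rewrite integral_mkcond -/F.
pose h := nnsfun_approx measurableT mF.
have Fh x : (h n x)%:E @[n --> \oo] --> F x by exact: cvg_nnsfun_approx.
have hS x : {homo (fun n => (h n x)%:E) : m n / (m <= n)%N >-> (m <= n)%E}.
  by move=> m n mn; rewrite lee_fin; exact/lefP/nd_nnsfun_approx.
transitivity (limn (fun n => \int[Q]_x (h n x)%:E)%E).
  rewrite -monotone_convergence//.
  - by apply: eq_integral => x _; apply/esym/cvg_lim => //; exact: Fh.
  - by move=> n; exact/measurable_EFinP.
  - by move=> n x _; rewrite lee_fin.
transitivity (limn (fun n => \int[mu]_x ((h n x)%:E * g x))%E).
  by congr (limn _); apply/funext => n; exact: integral_nnsfun_density.
rewrite -monotone_convergence//.
- apply: eq_integral => x _; apply/cvg_lim => //.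
  have [xD|xD] := boolP (x \in D).
    by rewrite /g patchT//; apply: cvgeZr => //; exact: Fh.
  rewrite /g patchN// mule0; apply: cvg_near_cst.
  by apply: nearW => n; rewrite mule0.
- by move=> n; apply: emeasurable_funM => //; exact/measurable_EFinP.
- by move=> n x _; rewrite mule_ge0// lee_fin.
- by move=> x _ m n mn; rewrite lee_wpmul2r//; exact: hS.
Qed.

(** The density is nonnegative, so the positive and negative parts of f q are those of
f times q, and the nonnegative case applies to each. *)
Lemma integral_density (f : T -> R) : measurable_fun D f ->
  (\int[Q]_(x in D) (f x)%:E = \int[mu]_(x in D) (f x * q x)%:E)%E.
Proof.
move=> mf; have mfE : measurable_fun D (EFin \o f) by exact/measurable_EFinP.
rewrite integralE [RHS]integralE.
rewrite (ge0_integral_density (measurable_funepos mfE)); last first.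
  by move=> x _; exact: funepos_ge0.
rewrite (ge0_integral_density (measurable_funeneg mfE)); last first.
  by move=> x _; exact: funeneg_ge0.
congr (_ - _)%E; apply: eq_integral => x /[!inE] /q0 qx.
- rewrite !funeposE /= -!EFin_max -EFinM; congr EFin.
  by rewrite maxr_pMl// mul0r.
- rewrite !funenegE /= -!EFin_max -EFinM; congr EFin.
  by rewrite maxr_pMl// mul0r mulNr.
Qed.

Lemma integrable_density (f : T -> R) : measurable_fun D f ->
  Q.-integrable D (EFin \o f) <-> mu.-integrable D (fun x => (f x * q x)%:E).
Proof.
move=> mf; have mfE : measurable_fun D (EFin \o f) by exact/measurable_EFinP.
have -> : Q.-integrable D (EFin \o f) <-> (\int[Q]_(x in D) `|(f x)%:E| < +oo)%E.
  by split=> [/integrableP[]//|?]; apply/integrableP.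
have -> : mu.-integrable D (fun x => (f x * q x)%:E) <->
    (\int[mu]_(x in D) `|(f x * q x)%:E| < +oo)%E.
  split=> [/integrableP[]//|?]; apply/integrableP; split => //.
  by apply/measurable_EFinP; exact: measurable_funM.
rewrite (@ge0_integral_density (fun x => `|(f x)%:E|)%E)//; last exact: measurableT_comp.
suff -> : (\int[mu]_(x in D) (`|(f x)%:E| * (q x)%:E) =
    \int[mu]_(x in D) `|(f x * q x)%:E|)%E by [].
apply: eq_integral => x /[!inE] /q0 qx.
by rewrite /= -EFinM normrM (ger0_norm qx).
Qed.

End density_integral.

(** * Existence of a dual minimiser *)

Section minimum.
Context (R : realType) (m : nat).

Lemma limn_einf_le (u : (\bar R)^nat) (a : R^nat) (l : R) :
  (forall k, (u k <= (a k)%:E)%E) -> a k @[k --> \oo] --> l ->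
  (limn_einf u <= l%:E)%E.
Proof.
move=> ua al.
have aEl : (a k)%:E @[k --> \oo] --> l%:E by apply: cvg_EFin => //; exact: nearW.
rewrite limn_einf_lim -(cvg_lim _ aEl)//; apply: lee_lim.
- exact: is_cvg_einfs.
- by apply/cvg_ex; exists l%:E.
- apply: nearW => n; apply: le_trans (ua n).
  by apply: ereal_inf_lbound; exists n => /=.
Qed.

(** Direct method: a minimising sequence stays in a box, and along a subsequence
converging to a cluster point semicontinuity passes to the limit. *)
Lemma lsc_coercive_attains_min (G : 'rV[R]_m -> \bar R) (x0 : 'rV[R]_m) :
  (forall x, 0 <= G x)%E -> (G x0 < +oo)%E ->
  (forall M : R, exists K : R, forall x, (G x <= M%:E)%E -> forall j, `|x 0 j| <= K) ->
  (forall (u : nat -> 'rV[R]_m) (p : 'rV[R]_m) (a : R^nat) (l : R),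
     (forall j, u k 0 j @[k --> \oo] --> p 0 j) -> a k @[k --> \oo] --> l ->
     (forall k, G (u k) <= (a k)%:E)%E -> (G p <= l%:E)%E) ->
  exists p, forall x, (G p <= G x)%E.
Proof.
move=> G0 Gx0 Gcoer Glsc.
have infle x : (ereal_inf (range G) <= G x)%E by apply: ereal_inf_lbound; exists x.
have inffin : ereal_inf (range G) \is a fin_num.
  rewrite ge0_fin_numE; first exact: le_lt_trans (infle x0) Gx0.
  by apply: le_ereal_inf_tmp => _ [x _ <-].
set r := fine (ereal_inf (range G)).
have rE : ereal_inf (range G) = r%:E by rewrite fineK.
have /choice[u uP] (k : nat) : exists x, (G x <= (r + k.+1%:R^-1)%:E)%E.
  have k0 : 0 < k.+1%:R^-1 :> R by rewrite invr_gt0.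
  have [_ [x _ <-]] := lb_ereal_inf_adherent k0 inffin.
  by rewrite rE -EFinD => /ltW; exists x.
have [K KP] := Gcoer (r + 1).
have uK k j : `|u k 0 j| <= K.
  apply: KP; apply: (le_trans (uP k)); rewrite lee_fin lerD2l.
  by rewrite invf_le1// ler1n.
have cbox := @rV_compact R m (fun=> `[(- K), K]%classic) (fun=> @segment_compact _ _ _).
have [|p [_ clp]] := cbox (u @ \oo) _.
  by exists 0%N => // k _ i /=; rewrite in_itv/= -ler_norml.
have /choice[phi phiP] (k : nat) : exists n, (k <= n)%N /\
    forall j, `|u n 0 j - p 0 j| < k.+1%:R^-1.
  have k0 : 0 < k.+1%:R^-1 :> R by rewrite invr_gt0.
  have nB := nbhsx_ballx p _ k0.
  have nA : (u @ \oo) [set x | exists2 n, (k <= n)%N & x = u n].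
    by exists k => // n /= kn; exists n.
  have [_ [[n kn ->] [_ pun]]] := clp _ _ nA nB.
  by exists n; split=> // j; have := pun 0 j; rewrite /ball /= distrC.
exists p => x; apply: le_trans (infle x); rewrite rE.
apply: (Glsc (fun k => u (phi k)) p (fun k => r + k.+1%:R^-1)).
- move=> j; apply/cvgrPdist_lt => e e0.
  have := @cvg_harmonic R; move/cvgrPdist_lt => /(_ e e0).
  apply: filterS => k /=; rewrite sub0r normrN ger0_norm ?invr_ge0// => ke.
  by rewrite distrC; apply: lt_trans ke; exact: (phiP k).2.
- rewrite -[X in _ --> X]addr0; apply: cvgD; first exact: cvg_cst.
  exact: cvg_harmonic.
- move=> k; apply: (le_trans (uP (phi k))); rewrite lee_fin lerD2l.
  by rewrite lef_pV2 ?posrE// ler_nat ltnS; exact: (phiP k).1.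
Qed.
End minimum.

Section dual.
Context (R : realType) (d m : nat).
Implicit Types (X Y S : sym R d) (lam y z : 'rV[R]_m).
Local Notation leb := (@lebesgue_sym R d).

Lemma dotp0 y : dotp 0 y = 0.
Proof. by rewrite /dotp big1// => j _; rewrite mxE mul0r. Qed.
Lemma dotpDr lam y z : dotp lam (y + z) = dotp lam y + dotp lam z.
Proof. by rewrite /dotp -big_split; apply: eq_bigr => j _; rewrite mxE mulrDr. Qed.
Lemma dotpZr lam a y : dotp lam (a *: y) = a * dotp lam y.
Proof. by rewrite /dotp mulr_sumr; apply: eq_bigr => j _; rewrite mxE mulrCA. Qed.
Lemma dotpNr lam y : dotp lam (- y) = - dotp lam y.
Proof. by rewrite -scaleN1r dotpZr mulN1r. Qed.
Lemma dotpDl lam mu y : dotp (lam + mu) y = dotp lam y + dotp mu y.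
Proof. by rewrite /dotp -big_split; apply: eq_bigr => j _; rewrite mxE mulrDl. Qed.
Lemma dotpZl a lam y : dotp (a *: lam) y = a * dotp lam y.
Proof. by rewrite /dotp mulr_sumr; apply: eq_bigr => j _; rewrite mxE mulrA. Qed.
Lemma dotp_deltar lam j : dotp lam (delta_mx 0 j) = lam 0 j.
Proof.
rewrite /dotp (bigD1 j)//= big1 ?addr0 => [|k kj]; rewrite mxE ?eqxx ?mulr1//.
by rewrite (negbTE kj) mulr0.
Qed.
Lemma dotp_deltal y j : dotp (delta_mx 0 j) y = y 0 j.
Proof.
rewrite /dotp (bigD1 j)//= big1 ?addr0 => [|k kj]; rewrite mxE ?eqxx ?mul1r//.
by rewrite (negbTE kj) mul0r.
Qed.

Section fixA.
Context (A0 : sym R d) (A : 'I_m -> sym R d).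
Hypothesis hA0 : pd R d A0.

Lemma hmapD X Y : hmap A (X + Y) = hmap A X + hmap A Y.
Proof. by apply/rowP => j; rewrite !mxE tripDr. Qed.
Lemma hmapZ a X : hmap A (a *: X) = a *: hmap A X.
Proof. by apply/rowP => j; rewrite !mxE tripZr. Qed.

Lemma trip_slack lam X : trip (slack A0 A lam) X = trip A0 X - dotp lam (hmap A X).
Proof.
rewrite /slack tripDl tripNl trip_suml; congr (_ - _).
by apply: eq_bigr => j _; rewrite tripZl mxE.
Qed.

Lemma slack0 : slack A0 A 0 = A0.
Proof. by rewrite /slack big1 ?subr0// => j _; rewrite mxE scale0r. Qed.

Lemma slackD lam mu : slack A0 A (lam + mu) = slack A0 A lam - \sum_(j < m) mu 0 j *: A j.
Proof.
rewrite /slack -addrA -opprD -big_split /=; congr (_ - _).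
by apply: eq_bigr => j _; rewrite mxE scalerDl.
Qed.

Lemma slackZ a lam : slack A0 A (a *: lam) = a *: slack A0 A lam + (1 - a) *: A0.
Proof.
rewrite /slack scalerBr scaler_sumr scalerBl scale1r [RHS]addrC subrKA.
congr (_ - _).
by apply: eq_bigr => j _; rewrite mxE scalerA.
Qed.

(** A sup-norm ball around y inside h(K). Unlike the topological formulation, this
is visibly stable under scaling of y. *)
Definition interior_moment y := exists2 del : R, 0 < del &
  forall z, (forall j, `|z 0 j - y 0 j| <= del) -> exists2 X, psd R d X & hmap A X = z.

Lemma interior_momentP y : interior (hmap A @` psd R d) y -> interior_moment y.
Proof.
move=> /nbhs_ballP[e /= e0 eP]; exists (e / 2); first by rewrite divr_gt0.
move=> z yz; have [|X hX <-] := eP z; last by exists X.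
split=> // i j; rewrite (ord1 i) /ball /= distrC.
by apply: (le_lt_trans (yz j)); lra.
Qed.

Lemma interior_momentZ a y : 0 < a -> interior_moment y -> interior_moment (a *: y).
Proof.
move=> a0 [del del0 hy]; exists (a * del); first exact: mulr_gt0.
move=> z yz; have [|X hX XE] := hy (a^-1 *: z).
  move=> j; have := yz j; rewrite !mxE => h.
  rewrite -(ler_pM2l a0); apply: le_trans h.
  rewrite -{1}(gtr0_norm a0) -normrM mulrBr mulrA divff ?mul1r// gt_eqF//.
exists (a *: X); first exact: psdZ (ltW a0) hX.
by rewrite hmapZ XE scalerA divff ?scale1r// gt_eqF.
Qed.

Context (y : 'rV[R]_m) (hy : interior_moment y).

(** Start slightly off y, at y - t h(I), and add t I to a preimage in the cone. *)
Lemma pd_moment : exists2 X, pd R d X & hmap A X = y.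
Proof.
have [del del0 hdel] := hy.
pose T := 1 + \sum_j `|trip (A j) idsym|.
have T0 : 0 < T by rewrite ltr_wpDr// sumr_ge0.
pose t := del / T.
have t0 : 0 < t by exact: divr_gt0.
have [|X hX XE] := hdel (y - t *: hmap A idsym).
  move=> j; rewrite !mxE addrAC subrr add0r normrN normrM gtr0_norm//.
  rewrite /t mulrAC ler_pdivrMr// ler_pM2l// /T (bigD1 j)//=.
  have : 0 <= \sum_(i < m | i != j) `|trip (A i) idsym| by rewrite sumr_ge0.
  by move: (\sum_(i < m | _) _) `|_| => a b; lra.
exists (X + t *: idsym); last by rewrite hmapD hmapZ XE subrK.
by rewrite addrC; apply: pdD => //; exact: pd_id.
Qed.

Lemma open_pd_sub (W : sym R d) : open [set X | pd R d (W - X)].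
Proof.
rewrite openE => X /= VX.
have /nbhs_symP[e e0 eV] : nbhs (W - X) (pd R d).
  by apply: open_nbhs_nbhs; split=> //; exact: open_pd.
apply/nbhs_symP; exists e => // Y XY; apply: eV => i j.
have := XY i j; rewrite distrC -!mx_of_symBE; congr (`|mx_of_sym _ _ _| < _).
by rewrite opprB [in RHS]addrC subrKA.
Qed.

(** On the open set of X between 0 and X0 / 2 in the Loewner order, <S, X> is at
most <S, X0> / 2 for every S in the cone; b is a lower bound for its measure. *)
Lemma laplace_lower X0 : pd R d X0 -> exists2 b : R, 0 < b &
  forall S, psd R d S -> ((b * expR (- (trip S X0 / 2)))%:E <= laplace S)%E.
Proof.
move=> hX0.
pose B := pd R d `&` [set X | pd R d (2^-1 *: X0 - X)].
have oB : open B by apply: openI; [exact: open_pd|exact: open_pd_sub].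
have mB : measurable B by exact: sub_sigma_algebra.
have BX : B (4^-1 *: X0).
  split=> /=; first exact: pdZ.
  by rewrite -scalerBl; apply: pdZ => //; lra.
have B0 : (0 < leb B)%E by exact: lebesgue_sym_open_gt0 BX.
have [b b0 bB] : exists2 b : R, 0 < b & (b%:E <= leb B)%E.
  move: B0; case: (leb B) => [r| |]//; first by rewrite lte_fin; exists r.
  by exists 1 => //; rewrite leey.
exists b => // S hS.
have tB X : B X -> trip S X <= trip S X0 / 2.
  move=> [_ /= /pd_psd hX]; have := trip_ge0 hS hX.
  by rewrite tripDr tripNr tripZr; lra.
apply: (@le_trans _ _ (\int[leb]_(X in B) (expR (- trip S X))%:E)%E).
  apply: le_trans (integral_expR_ge mB tB).
  by rewrite mulrC EFinM lee_wpmul2l// lee_fin expR_ge0.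
apply: ge0_subset_integral => //; first exact: measurable_psd.
- exact: measurable_fun_expR_trip.
- by move=> X [/pd_psd].
Qed.

(** The exponential of minus the dual objective <lam, y> - phi(S(lam)). Minimising it
avoids the value -oo of the objective outside the domain of phi. *)
Definition dual_obj lam : \bar R :=
  ((expR (- dotp lam y))%:E * laplace (slack A0 A lam))%E.

Lemma dual_obj_ge0 lam : (0 <= dual_obj lam)%E.
Proof. by rewrite mule_ge0 ?laplace_ge0// lee_fin expR_ge0. Qed.

(** As a function of lam, an integral of exponentials of affine functions. *)
Lemma dual_objE lam : dual_obj lam =
  (\int[leb]_(X in psd R d) (expR (- trip A0 X + dotp lam (hmap A X - y)))%:E)%E.
Proof.
rewrite /dual_obj /laplace -ge0_integralZl//.
- apply: eq_integral => X _; rewrite -EFinM -expRD trip_slack.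
  by congr ((expR _)%:E); rewrite dotpDr dotpNr; ring.
- exact: measurable_psd.
- exact: measurable_fun_expR_trip.
Qed.

Lemma dual_obj_lty lam : (dual_obj lam < +oo)%E -> (laplace (slack A0 A lam) < +oo)%E.
Proof.
rewrite /dual_obj; have := laplace_ge0 (slack A0 A lam).
case: (laplace _) => [r||]// _; rewrite ?ltry// gt0_muley// lte_fin.
exact: expR_gt0.
Qed.

(** If X has moments y + del e_j or y - del e_j, then 0 <= <S(lam), X> bounds
+- del lam_j by a constant minus <lam, y>. A bound on G gives one on -<lam, y>
because, by [laplace_lower], G is at least a multiple of exp(-<lam, y> / 2). *)
Lemma dual_obj_coercive (M : R) : exists K : R, forall lam,
  (dual_obj lam <= M%:E)%E -> forall j, `|lam 0 j| <= K.
Proof.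
have [X0 hX0 X0E] := pd_moment.
have [b b0 bP] := laplace_lower hX0.
have [del del0 hdel] := hy.
pose C := (ln (`|M| + 1) - ln b) * 2 + trip A0 X0.
have levelC lam : (dual_obj lam <= M%:E)%E ->
    psd R d (slack A0 A lam) /\ - dotp lam y <= C.
  move=> GM.
  have Soo : (laplace (slack A0 A lam) < +oo)%E.
    by apply: dual_obj_lty; apply: (le_lt_trans GM); rewrite ltry.
  have hS := pd_psd (laplace_lty_pd Soo); split => //.
  have : ((b * expR (- (dotp lam y + trip A0 X0) / 2))%:E <= M%:E)%E.
    apply: le_trans GM; rewrite /dual_obj.
    apply: (@le_trans _ _ ((expR (- dotp lam y))%:E *
        (b * expR (- (trip (slack A0 A lam) X0 / 2)))%:E)%E).
      rewrite -EFinM lee_fin mulrCA -expRD trip_slack X0E.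
      by rewrite le_eqVlt; apply/orP; left; apply/eqP; congr (_ * expR _); field.
    by rewrite lee_wpmul2l ?lee_fin ?expR_ge0//; exact: bP.
  rewrite lee_fin => h.
  have : b * expR (- (dotp lam y + trip A0 X0) / 2) <= `|M| + 1.
    by apply: (le_trans h); have := ler_norm M; lra.
  have M0 : 0 < `|M| + 1 by rewrite ltr_wpDl.
  rewrite -ler_ln ?posrE ?mulr_gt0 ?expR_gt0// lnM ?posrE ?expR_gt0// expRK.
  by rewrite /C; lra.
have /choice[Xp XpP] (j : 'I_m) : exists X, psd R d X /\ hmap A X = y + del *: delta_mx 0 j.
  have [|X hX XE] := hdel (y + del *: delta_mx 0 j); last by exists X.
  move=> k; rewrite !mxE addrAC subrr add0r normrM gtr0_norm//.
  rewrite ler_piMr ?(ltW del0)//.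
  by case: (_ && _); rewrite ?normr1 ?normr0 ?ler01.
have /choice[Xm XmP] (j : 'I_m) : exists X, psd R d X /\ hmap A X = y - del *: delta_mx 0 j.
  have [|X hX XE] := hdel (y - del *: delta_mx 0 j); last by exists X.
  move=> k; rewrite !mxE addrAC subrr add0r normrN normrM gtr0_norm//.
  rewrite ler_piMr ?(ltW del0)//.
  by case: (_ && _); rewrite ?normr1 ?normr0 ?ler01.
pose T := \sum_j (`|trip A0 (Xp j)| + `|trip A0 (Xm j)|).
exists ((T + C) / del) => lam /levelC[hS hC] j.
have hT : `|trip A0 (Xp j)| + `|trip A0 (Xm j)| <= T.
  by rewrite /T (bigD1 j)//= lerDl sumr_ge0// => k _; rewrite addr_ge0.
have [hXp hXpE] := XpP j; have [hXm hXmE] := XmP j.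
have := trip_ge0 hS hXp; have := trip_ge0 hS hXm.
rewrite !trip_slack hXpE hXmE !dotpDr dotpNr !dotpZr dotp_deltar.
have := ler_norm (trip A0 (Xp j)); have := ler_norm (trip A0 (Xm j)).
have := normr_ge0 (trip A0 (Xp j)); have := normr_ge0 (trip A0 (Xm j)).
move=> h1 h2 h3 h4 h5 h6.
rewrite ler_pdivlMr// -(gtr0_norm del0) -normrM ler_norml; apply/andP.
by split; lra.
Qed.

(** Fatou's lemma applied to [dual_objE]. *)
Lemma dual_obj_lsc (u : nat -> 'rV[R]_m) (p : 'rV[R]_m) (a : R^nat) (l : R) :
  (forall j, u k 0 j @[k --> \oo] --> p 0 j) -> a k @[k --> \oo] --> l ->
  (forall k, dual_obj (u k) <= (a k)%:E)%E -> (dual_obj p <= l%:E)%E.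
Proof.
move=> up al ua.
pose f k X : \bar R := (expR (- trip A0 X + dotp (u k) (hmap A X - y)))%:E.
have mf k : measurable_fun (psd R d) (f k).
  apply: measurable_funTS; apply/measurable_EFinP; apply: measurableT_comp => //.
  apply: measurable_funD.
    by apply: measurableT_comp => //; exact: measurable_trip.
  apply: measurable_sum => j; apply: measurable_funM => //.
  rewrite (_ : (fun _ => _) = fun X => trip (A j) X - y 0 j); last first.
    by apply/funext => X; rewrite !mxE.
  by apply: measurable_funB => //; exact: measurable_trip.
have f0 k X : psd R d X -> (0 <= f k X)%E by rewrite /f lee_fin expR_ge0.
apply: (@le_trans _ _ (limn_einf (fun k => dual_obj (u k)))); last first.
  exact: limn_einf_le ua al.
rewrite [leRHS](_ : _ = limn_einf (fun k => \int[leb]_(X in psd R d) f k X)%E); last first.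
  by congr limn_einf; apply/funext => k; rewrite dual_objE.
apply: le_trans (fatou leb (@measurable_psd R d) mf f0).
rewrite dual_objE le_eqVlt; apply/orP; left; apply/eqP; apply: eq_integral => X _.
apply/esym; apply: (cvg_limn_einf_sup _).1; rewrite /f.
apply: cvg_EFin; first exact: nearW.
apply: (@continuous_cvg _ _ _ _ _ _ (@expR R)); first exact: continuous_expR.
apply: cvgD; first exact: cvg_cst.
have cvg_sum n (F : 'I_n -> nat -> R) (L : 'I_n -> R) :
    (forall i, F i k @[k --> \oo] --> L i) ->
    \sum_(i < n) F i k @[k --> \oo] --> \sum_(i < n) L i.
  move=> FX; elim: (index_enum _) => [|i s IH].
    by under eq_fun do rewrite big_nil; rewrite big_nil; exact: cvg_cst.
  by under eq_fun do rewrite big_cons; rewrite big_cons; exact: cvgD (FX i) IH.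
by apply: (cvg_sum) => j; apply: cvgM; [exact: up|exact: cvg_cst].
Qed.

Lemma dual_attained : exists lam, pd R d (slack A0 A lam) /\
  forall mu, (dual_obj lam <= dual_obj mu)%E.
Proof.
have G0 : (dual_obj 0 < +oo)%E.
  by rewrite /dual_obj dotp0 oppr0 expR0 mul1e slack0; exact: laplace_lty.
have [p pP] := lsc_coercive_attains_min dual_obj_ge0 G0 dual_obj_coercive dual_obj_lsc.
exists p; split => //; apply/laplace_lty_pd/dual_obj_lty.
exact: le_lt_trans (pP 0) G0.
Qed.

End fixA.
End dual.

(** * First-order condition for exponential families *)

Section quadratic.
Context (R : realType).

(** A Taylor bound whose remainder can be integrated against exponential densities. *)
Lemma expR_le_quad (x : R) : expR x <= 1 + x + x ^+ 2 * expR `|x|.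
Proof.
have e1 := expR_ge1Dx (- x); have e2 := expR_ge1Dx x.
have e0 : 0 < expR x by exact: expR_gt0.
have xe : expR x - 1 <= x * expR x.
  have : (1 - x) * expR x <= expR (- x) * expR x by rewrite ler_pM2r.
  by rewrite -expRD addNr expR0; lra.
have [x0|x0] := leP 0 x.
  by rewrite ger0_norm//; nra.
rewrite ltr0_norm//.
have : 1 <= expR (- x) by rewrite -expR0 ler_expR oppr_ge0 ltW.
by move: (expR (- x)) e1 => E e1 E1; nra.
Qed.

Lemma linear_nonneg_eq0 (a b t0 : R) : 0 < t0 ->
  (forall t, `|t| <= t0 -> 0 <= t * a + t ^+ 2 * b) -> a = 0.
Proof.
move=> t00 h; apply/eqP/negP => /negP a0.
(* at t = - s a the linear term dominates the quadratic one *)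
pose s := Num.min (t0 / `|a|) (2 * (`|b| + 1))^-1.
have na : 0 < `|a| by rewrite normr_gt0.
have nb : 0 < `|b| + 1 by rewrite ltr_wpDl.
have s0 : 0 < s by rewrite lt_min divr_gt0// invr_gt0 mulr_gt0.
have s1 : s * `|a| <= t0 by rewrite -ler_pdivlMr// ge_min lexx.
have s2 : s * (2 * (`|b| + 1)) <= 1.
  by rewrite -ler_pdivlMr ?mulr_gt0// mul1r ge_min lexx orbT.
have /h : `|- s * a| <= t0 by rewrite mulNr normrN normrM gtr0_norm.
rewrite (_ : _ + _ = - (s * a ^+ 2) * (1 - s * b)); last by ring.
have : 0 < s * a ^+ 2 by rewrite mulr_gt0// exprn_even_gt0.
have := ler_norm b; move: (a ^+ 2) (`|b|) s2 => A B s2 bB sA.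
have : s * b <= s * B by rewrite ler_pM2l.
by move=> sb; rewrite mulNr oppr_ge0 pmulr_rle0//; lra.
Qed.
End quadratic.

Section integral_le.
Context d (T : measurableType d) (R : realType) (mu : {measure set T -> \bar R}).
(** The upper function may have integral +oo, as the entropy integrand may. *)
Lemma integrable_le_integral (D : set T) (f g : T -> \bar R) : measurable D ->
  measurable_fun D f -> mu.-integrable D g -> (forall x, D x -> (g x <= f x)%E) ->
  (\int[mu]_(x in D) g x <= \int[mu]_(x in D) f x)%E.
Proof.
move=> mD mf intg gf; have mg := measurable_int _ intg.
rewrite integralE [leRHS]integralE; apply: leeB.
- apply: ge0_le_integral => //; [exact: measurable_funepos|exact: measurable_funepos|].
  move=> x Dx; rewrite !funeposE ge_max le_max gf//= le_max lexx orbT//.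
- apply: ge0_le_integral => //; [exact: measurable_funeneg|exact: measurable_funeneg|].
  move=> x Dx; rewrite !funenegE ge_max le_max leeN2 gf//= le_max lexx orbT//.
Qed.
End integral_le.

Section first_order.
Context (R : realType) (d : nat).
Implicit Types (S V W X : sym R d).
Local Notation leb := (@lebesgue_sym R d).
Local Notation int f := (leb.-integrable (pd R d) (EFin \o f)).
Local Notation I f := (\int[leb]_(X in pd R d) f X).
Local Notation w S := (fun X => expR (- trip S X)).

Lemma pd_perturb S W : pd R d S ->
  exists2 t0 : R, 0 < t0 & forall t, `|t| <= t0 -> pd R d (S + t *: W).
Proof.
move=> hS; have /nbhs_symP[e e0 eV] : nbhs S (pd R d).
  by apply: open_nbhs_nbhs; split=> //; exact: open_pd.
pose T := 1 + \sum_i \sum_j `|mx_of_sym W i j|.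
have T0 : 0 < T by rewrite ltr_wpDr// sumr_ge0// => i _; rewrite sumr_ge0.
exists (e / T); first exact: divr_gt0.
move=> t tT; apply: eV => i j.
rewrite -mx_of_symBE addrAC subrr add0r mx_of_symZ mxE normrM.
have WT : `|mx_of_sym W i j| < T.
  apply: (@le_lt_trans _ _ (\sum_i \sum_j `|mx_of_sym W i j|)); last by rewrite ltrDr.
  rewrite (bigD1 i)//= (bigD1 j)//= -addrA lerDl addr_ge0 ?sumr_ge0// => k _.
  by rewrite sumr_ge0.
apply: (@le_lt_trans _ _ (e / T * `|mx_of_sym W i j|)); first exact: ler_wpM2r.
by rewrite mulrAC ltr_pdivrMr// ltr_pM2l.
Qed.

Lemma measurable_expR_trip D S : measurable_fun D (w S).
Proof. by apply/measurable_EFinP; exact: measurable_fun_expR_trip. Qed.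

Lemma integrable_expR S : pd R d S -> int (w S).
Proof.
move=> hS; apply/integrableP; split; first exact: measurable_fun_expR_trip.
rewrite (eq_integral (fun X => (expR (- trip S X))%:E)).
  by rewrite -laplaceE; exact: laplace_lty.
by move=> X _; rewrite /= ger0_norm// expR_ge0.
Qed.

Lemma Rintegral_expR S : I (w S) = fine (laplace S).
Proof. by rewrite /Rintegral -laplaceE. Qed.

Lemma Rintegral_EFin (f : sym R d -> R) : int f ->
  (\int[leb]_(X in pd R d) (f X)%:E)%E = (I f)%:E.
Proof.
move=> hf; rewrite /Rintegral fineK//.
exact: (integrable_fin_num (@measurable_pd R d) hf).
Qed.

Lemma intD (f g : sym R d -> R) : int f -> int g -> int (fun X => f X + g X).
Proof. by move=> hf hg; exact: (integrableD (@measurable_pd R d) hf hg). Qed.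
Lemma intZ a (f : sym R d -> R) : int f -> int (fun X => a * f X).
Proof. by move=> hf; exact: (integrableZl (@measurable_pd R d) a hf). Qed.

(** With g = <W, .> - a, minimality at t = 0 says that the integral of w exp(t g) is
at least that of w. By [expR_le_quad] it is at most the integral of
w + t w g + t^2 h with h integrable, so the linear coefficient vanishes.  The
bound t1 on the perturbation is three times t0 because u^2 exp(u) is estimated by
exp(3 u). *)
Lemma first_order S W (a : R) : pd R d S ->
  (forall t : R, (laplace S <= (expR (- (t * a)))%:E * laplace (S - t *: W)%R)%E) ->
  int (fun X => w S X * trip W X) /\ I (fun X => w S X * trip W X) = a * I (w S).
Proof.
move=> hS hmin.
have mpd := @measurable_pd R d.
have [t1 t10 t1P] := pd_perturb W hS.
pose t0 := t1 / 3; have t00 : 0 < t0 by rewrite divr_gt0.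
pose g X := trip W X - a.
have mg D : measurable_fun D g.
  by apply: measurable_funTS; apply: measurable_funB => //; exact: measurable_trip.
pose F t X := w S X * expR (t * g X).
have FE t : F t = fun X => expR (- (t * a)) * w (S - t *: W) X.
  apply/funext => X; rewrite /F -!expRD; congr expR.
  by rewrite tripDl tripNl tripZl /g; ring.
have hpd t : `|t| <= t1 -> pd R d (S - t *: W).
  by move=> tt; rewrite -scaleNr; apply: t1P; rewrite normrN.
have intF t : `|t| <= t1 -> int (F t).
  by move=> /hpd h; rewrite FE; apply: intZ; exact: integrable_expR.
have IF t : `|t| <= t1 -> I (w S) <= I (F t).
  move=> tt; rewrite FE RintegralZl//; last by apply: integrable_expR; exact: hpd.
  rewrite !Rintegral_expR.
  have fin V : pd R d V -> laplace V \is a fin_num.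
    by move=> hV; rewrite ge0_fin_numE ?laplace_ge0// laplace_lty.
  have := hmin t; rewrite -(fineK (fin _ hS)) -(fineK (fin _ (hpd t tt))).
  by rewrite -EFinM lee_fin.
pose h X := t0 ^- 2 * (F t1 X + F (- t1) X).
have inth : int h.
  by apply: intZ; apply: intD; apply: intF; rewrite ?normrN gtr0_norm.
have he X : w S X * (t0 ^- 2 * expR (t1 * `|g X|)) <= h X.
  rewrite /h /F -mulrDr mulrCA ler_pM2l ?invr_gt0 ?exprn_gt0// ler_pM2l ?expR_gt0//.
  have [g0|g0] := leP 0 (g X); rewrite ?(ger0_norm g0) ?(ltr0_norm g0).
    by rewrite lerDl expR_ge0.
  by rewrite mulrN mulNr lerDr expR_ge0.
have uexp (u : R) : u <= expR u by have := expR_ge1Dx u; lra.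
have t1E : t1 = 3 * t0 by rewrite /t0; field.
have t0V : t0 * t0^-1 = 1 by rewrite divff ?gt_eqF.
have intwg : int (fun X => w S X * g X).
  apply: (@le_integrable _ _ _ _ _ mpd _ (EFin \o (fun X => t0 * h X))) => //.
  - apply/measurable_EFinP; apply: measurable_funM => //.
    exact: measurable_expR_trip.
  - move=> X _ /=; rewrite lee_fin normrM (gtr0_norm (expR_gt0 _)).
    apply: le_trans (ler_norm _).
    apply: (@le_trans _ _
      (t0 * (w S X * (t0 ^- 2 * expR (t1 * `|g X|))))); last first.
      by rewrite ler_pM2l.
    rewrite mulrCA ler_pM2l ?expR_gt0// mulrA expr2 invfM mulrA t0V mul1r.
    rewrite -(ler_pM2l t00) mulrA t0V mul1r.
    apply: (le_trans (uexp _)); rewrite ler_expR t1E.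
    have : 0 <= t0 * `|g X| by rewrite mulr_ge0// ltW.
    by lra.
  - exact: intZ.
have IwgE : I (fun X => w S X * g X) = 0.
  apply: (@linear_nonneg_eq0 _ _ (I h) t0 t00) => t tt0.
  have tt1 : `|t| <= t1 by lra.
  have : I (F t) <= I (fun X => (w S X + t * (w S X * g X)) + t ^+ 2 * h X).
    apply: le_Rintegral => //; first exact: intF.
      apply: intD; last exact: intZ.
      by apply: intD; [exact: integrable_expR|exact: intZ].
    move=> X _.
    apply: (@le_trans _ _ (w S X + t * (w S X * g X) +
      t ^+ 2 * (w S X * (t0 ^- 2 * expR (t1 * `|g X|))))); last first.
      by rewrite lerD2l ler_wpM2l ?sqr_ge0.
    rewrite (_ : _ + _ + _ = w S X * (1 + t * g X +
      t ^+ 2 * (t0 ^- 2 * expR (t1 * `|g X|)))); last by ring.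
    rewrite /F ler_pM2l ?expR_gt0//; apply: (le_trans (expR_le_quad _)).
    rewrite lerD2l exprMn -mulrA ler_wpM2l ?sqr_ge0// normrM.
    set u := `|g X|; have u0 : 0 <= u by exact: normr_ge0.
    have -> : g X ^+ 2 = t0 ^- 2 * (t0 * u) ^+ 2.
      by rewrite [(t0 * u) ^+ 2]exprMn mulKf ?expf_neq0 ?gt_eqF// /u real_normK ?num_real.
    rewrite -mulrA ler_pM2l ?invr_gt0 ?exprn_gt0//.
    apply: (@le_trans _ _ (expR (t0 * u) ^+ 2 * expR (t0 * u))).
      apply: ler_pM; rewrite ?sqr_ge0 ?expR_ge0//.
        have tu0 : 0 <= t0 * u by rewrite mulr_ge0// ltW.
        by apply: lerXn2r (uexp _); rewrite nnegrE// expR_ge0.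
      by rewrite ler_expR ler_wpM2r.
    by rewrite -exprSr -expRM_natl ler_expR t1E mulrA.
  have := IF t tt1; move=> /le_trans /[apply].
  have i0 := integrable_expR hS; have i1 := intZ t intwg.
  rewrite (RintegralD _ (intD i0 i1) (intZ (t ^+ 2) inth))// (RintegralD _ i0 i1)//.
  rewrite (RintegralZl _ mpd intwg) (RintegralZl _ mpd inth).
  by move=> IFle; rewrite -(lerDl (I (w S))) addrA.
have E : (fun X => w S X * trip W X) = fun X => w S X * g X + a * w S X.
  by apply/funext => X; rewrite /g; ring.
have intw := integrable_expR hS.
rewrite E; split; first by apply: intD => //; exact: intZ.
by rewrite RintegralD ?RintegralZl ?IwgE ?add0r//; exact: intZ.
Qed.

End first_order.

(** * Gibbs measures and entropy duality *)

Section gibbs_theory.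
Context (R : realType) (d : nat).
Implicit Types (S V W X : sym R d).
Local Notation leb := (@lebesgue_sym R d).
Local Notation int f := (leb.-integrable (pd R d) (EFin \o f)).
Local Notation I f := (\int[leb]_(X in pd R d) f X).

Lemma laplace_fin_num S : pd R d S -> laplace S \is a fin_num.
Proof. by move=> hS; rewrite ge0_fin_numE ?laplace_ge0// laplace_lty. Qed.

Lemma gibbs_const_gt0 S : pd R d S -> 0 < gibbs_const S.
Proof.
move=> hS; rewrite invr_gt0 fine_gt0// laplace_gt0 laplace_lty//.
Qed.

Lemma log_barrierE S : pd R d S -> log_barrier S = (- ln (gibbs_const S))%:E.
Proof.
move=> hS; rewrite /log_barrier -(fineK (laplace_fin_num hS)).
have := gibbs_const_gt0 hS; rewrite /gibbs_const invr_gt0 => z0.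
by rewrite lne_EFin// lnV ?posrE// opprK.
Qed.

Lemma measurable_gibbs_pdf D S : measurable_fun D (gibbs_pdf S).
Proof. by apply: measurable_funM => //; exact: measurable_expR_trip. Qed.

Lemma gibbs_pdf_gt0 S X : pd R d S -> 0 < gibbs_pdf S X.
Proof. by move=> hS; rewrite mulr_gt0 ?expR_gt0// gibbs_const_gt0. Qed.

Lemma integrable_gibbs_pdf S : pd R d S -> int (gibbs_pdf S).
Proof. by move=> hS; apply: intZ; exact: integrable_expR. Qed.

Lemma Rintegral_gibbs_pdf S : pd R d S -> I (gibbs_pdf S) = 1.
Proof.
move=> hS; rewrite RintegralZl//; [|exact: measurable_pd|exact: integrable_expR].
rewrite Rintegral_expR mulVf// gt_eqF// fine_gt0// laplace_gt0 laplace_lty//.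
Qed.

(** The Gibbs density is positive, so Gibbs-null sets are Lebesgue-null in the
interior of the cone; this yields the absolute continuity of the optimal
measure. *)
Lemma gibbs_null V B : pd R d V -> measurable B -> gibbs V B = 0%E ->
  leb (B `&` pd R d) = 0%E.
Proof.
move=> hV mB VB.
have mBp : measurable (B `&` pd R d) by apply: measurableI => //; exact: measurable_pd.
apply: (@integral_expR_eq0 _ _ V) => //; apply/eqP.
move/eqP: VB; rewrite /gibbs.
under eq_integral do rewrite EFinM.
rewrite ge0_integralZl//.
- by rewrite mule_eq0 eqe gt_eqF ?gibbs_const_gt0.
- exact: measurable_fun_expR_trip.
- by rewrite lee_fin ltW// gibbs_const_gt0.
Qed.

Lemma gibbs_probability V S : pd R d V -> pd R d S ->
  exists Q : probability (sym R d) R, Q `<< gibbs V /\ is_pdf Q (gibbs_pdf S).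
Proof.
move=> hV hS.
have mpd := @measurable_pd R d.
have q0 X : pd R d X -> 0 <= gibbs_pdf S X by rewrite ltW// gibbs_pdf_gt0.
have mq := @measurable_gibbs_pdf (pd R d) S.
have [|Q QE] := density_probability (mu := leb) mpd mq q0.
  by rewrite Rintegral_EFin ?Rintegral_gibbs_pdf//; exact: integrable_gibbs_pdf.
exists Q; split; last by split.
move=> N VN B mB BN; have /(gibbs_null hV mB) B0 := VN _ mB BN.
rewrite QE; apply: null_set_integral => //; first exact: measurableI.
by apply/measurable_EFinP; exact: measurable_gibbs_pdf.
Qed.

Lemma ln_exp_ratio (a b u v : R) : 0 < a -> 0 < b ->
  ln (a * expR (- u) / (b * expR (- v))) = ln a - ln b + (v - u).
Proof.
move=> a0 b0; rewrite ln_div ?posrE ?mulr_gt0 ?expR_gt0//.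
by rewrite !lnM ?posrE ?expR_gt0// !expRK; ring.
Qed.

Lemma ln_gibbs_pdf_div V S X : pd R d V -> pd R d S ->
  ln (gibbs_pdf S X / gibbs_pdf V X) =
  ln (gibbs_const S) - ln (gibbs_const V) + (trip V X - trip S X).
Proof.
by move=> hV hS; exact: ln_exp_ratio (gibbs_const_gt0 hS) (gibbs_const_gt0 hV).
Qed.

(** Nonnegativity of relative entropy in pointwise form: q ln(q/r) >= q - r, from
ln x <= x - 1 at x = r/q. *)
Lemma entropy_lower (q r p : R) : 0 <= q -> 0 < r -> 0 < p ->
  q * ln (r / p) + (q - r) <= q * ln (q / p).
Proof.
rewrite le_eqVlt => /orP[/eqP <-|q0] r0 p0; first by rewrite !mul0r; lra.
have h : ln (r / q) <= r / q - 1.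
  have rq : 0 < r / q by exact: divr_gt0.
  by have := expR_ge1Dx (ln (r / q)); rewrite lnK ?posrE//; lra.
rewrite !ln_div ?posrE// in h *.
have : q * (ln r - ln q) <= q * (r / q - 1) by rewrite ler_pM2l.
rewrite [leRHS]mulrBr mulr1 mulrCA divff ?gt_eqF// mulr1.
by move: (ln r) (ln q) (ln p) => a b c; rewrite !mulrBr; lra.
Qed.

End gibbs_theory.

Section duality.
Context (R : realType) (d m : nat).
Implicit Types (S V W X : sym R d) (y lam mu : 'rV[R]_m).
Local Notation leb := (@lebesgue_sym R d).
Local Notation int f := (leb.-integrable (pd R d) (EFin \o f)).
Local Notation I f := (\int[leb]_(X in pd R d) f X).
Context (A0 : sym R d) (A : 'I_m -> sym R d).
Hypothesis hA0 : pd R d A0.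
Local Notation sl lam := (slack A0 A lam).
Local Notation c0 := (gibbs_const A0).

Section feasible.
Variables (y : 'rV[R]_m) (Q : probability (sym R d) R) (q : sym R d -> R).
Hypotheses (Qq : is_pdf Q q) (Qm : has_moments Q A y).

Let q0 X : pd R d X -> 0 <= q X. Proof. by case: Qq => _ + _; exact. Qed.
Let mq : measurable_fun (pd R d) q. Proof. by case: Qq. Qed.
Let QE B : measurable B -> Q B = (\int[leb]_(X in B `&` pd R d) (q X)%:E)%E.
Proof. by case: Qq => _ _; exact. Qed.
Let mpd : measurable (pd R d). Proof. exact: measurable_pd. Qed.

Lemma pdf_integrable : int q.
Proof.
apply/integrableP; split; first exact/measurable_EFinP.
rewrite (eq_integral (fun X => (q X)%:E)); last first.
  by move=> X /[!inE] /q0 qX; rewrite /= ger0_norm.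
by have := QE measurableT; rewrite setTI => <-; rewrite probability_setT ltry.
Qed.

Lemma pdf_Rintegral : I q = 1.
Proof.
have := QE measurableT; rewrite setTI probability_setT.
by rewrite Rintegral_EFin ?pdf_integrable// => -[].
Qed.

Lemma pdf_moments j : int (fun X => trip (A j) X * q X) /\
  I (fun X => trip (A j) X * q X) = y 0 j.
Proof.
have [Qi QI] := Qm j.
have mt : measurable_fun (pd R d) (trip (A j)).
  by apply: measurable_funTS; exact: measurable_trip.
have ti : int (fun X => trip (A j) X * q X).
  exact/(integrable_density mpd mq q0 QE mt).
split=> //; move: QI; rewrite (integral_density mpd mq q0 QE mt).
by rewrite (Rintegral_EFin ti) => -[].
Qed.

(** The constraints fix the expectation of every linear combination of the moments. *)
Lemma pdf_dotp lam : int (fun X => dotp lam (hmap A X) * q X) /\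
  I (fun X => dotp lam (hmap A X) * q X) = dotp lam y.
Proof.
pose f j X := lam 0 j * (trip (A j) X * q X).
have fE : (fun X => dotp lam (hmap A X) * q X) = fun X => \sum_(j < m) f j X.
  apply/funext => X; rewrite /dotp mulr_suml; apply: eq_bigr => j _.
  by rewrite /f mxE mulrA.
have fi j : int (f j) by apply: intZ; have [] := pdf_moments j.
have fI j : I (f j) = lam 0 j * y 0 j.
  by have [h1 h2] := pdf_moments j; rewrite RintegralZl// h2.
rewrite fE /dotp; elim: (index_enum _) => [|j s [IHi IHI]].
  rewrite big_nil (_ : (fun _ => _) = cst 0); last by apply/funext => X; rewrite big_nil.
  split; last by rewrite /Rintegral integral0.
  exact: integrable0.
rewrite big_cons (_ : (fun _ => _) = fun X => f j X + \sum_(i <- s) f i X); last first.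
  by apply/funext => X; rewrite big_cons.
split; first exact: intD.
by rewrite RintegralD// fI IHI.
Qed.

(** Integrate [entropy_lower] with r the Gibbs density of the slack: ln(r/p) is
affine in the moments, and q - r integrates to 0. If the Laplace transform of
the slack is infinite, the bound is -oo. *)
Lemma weak_duality lam : psd R d (sl lam) ->
  ((dotp lam y)%:E - log_barrier (sl lam) - (ln c0)%:E <=
    rel_entropy q (gibbs_pdf A0))%E.
Proof.
move: (sl lam) (trip_slack A0 A lam) => S tripS hS.
have [Soo|] := boolP (laplace S < +oo)%E; last first.
  by rewrite -leNgt leye_eq /log_barrier => /eqP ->; rewrite /= addeNy// addNye leNye.
have pS := laplace_lty_pd Soo.
pose g X := ((ln (gibbs_const S) - ln c0) * q X + dotp lam (hmap A X) * q X) +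
   (q X - gibbs_pdf S X).
have [dI dE] := pdf_dotp lam.
have qI := pdf_integrable; have rI := integrable_gibbs_pdf pS.
have gI1 : int (fun X => (ln (gibbs_const S) - ln c0) * q X + dotp lam (hmap A X) * q X).
  exact: (intD (intZ _ qI) dI).
have gI2 : int (fun X => q X - gibbs_pdf S X) by exact: (integrableB mpd qI rI).
have gI : int g by exact: intD.
have gE : I g = dotp lam y + ln (gibbs_const S) - ln c0.
  rewrite (RintegralD mpd gI1 gI2) (RintegralD mpd (intZ _ qI) dI).
  rewrite (RintegralZl _ mpd qI) (RintegralB mpd qI rI) dE pdf_Rintegral.
  rewrite (Rintegral_gibbs_pdf pS).
  by rewrite mulr1 subrr addr0 addrC addrA.
rewrite log_barrierE// -EFinN -!EFinD opprK -gE -(Rintegral_EFin gI) /rel_entropy.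
apply: integrable_le_integral => //.
  apply/measurable_EFinP; apply: measurable_funM => //.
  apply: measurableT_comp => //; apply: measurable_funM => //.
  rewrite (_ : (fun _ => _) = fun X => (c0^-1 * expR (trip A0 X))); last first.
    apply/funext => X; rewrite /gibbs_pdf; move: c0 (trip A0 X) => a u.
    by rewrite invfM expRN invrK.
  apply: measurable_funM => //; apply: measurableT_comp => //.
  by apply: measurable_funTS; exact: measurable_trip.
move=> X hX; rewrite lee_fin.
apply: le_trans (entropy_lower (q0 hX) (gibbs_pdf_gt0 X pS) (gibbs_pdf_gt0 X hA0)).
rewrite ln_gibbs_pdf_div// /g tripS lerD2r.
by rewrite subKr [leRHS]mulrC [leRHS]mulrDl.
Qed.

End feasible.

Lemma slack_delta lam t j : sl (lam + t *: delta_mx 0 j) = sl lam - t *: A j.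
Proof.
rewrite slackD (bigD1 j)// big1 => [|k kj]; last first.
  by rewrite !mxE (negbTE kj) andbF mulr0 scale0r.
by rewrite /= addr0 !mxE !eqxx mulr1.
Qed.

(** The Gibbs density of the slack at the minimiser. Varying lam along e_j is varying
the slack along A_j, so [first_order] gives the j-th moment; the entropy is then
the expectation of an affine function of the moments. *)
Lemma primal_point y lam : pd R d (sl lam) ->
  (forall mu, dual_obj A0 A y lam <= dual_obj A0 A y mu)%E ->
  exists (Q : probability (sym R d) R) (q : sym R d -> R),
    [/\ Q `<< gibbs A0, is_pdf Q q, has_moments Q A y &
     rel_entropy q (gibbs_pdf A0) =
       (dotp lam y + ln (gibbs_const (sl lam)) - ln c0)%:E].
Proof.
move=> hS lamin; set S := sl lam in hS *.
have mpd := @measurable_pd R d.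
have [Q [Qdom Qq]] := gibbs_probability hA0 hS.
have [mq q0 QE] := Qq.
have fo j := @first_order R d S (A j) (y 0 j) hS.
have hmin j t : (laplace S <= (expR (- (t * y 0 j)))%:E * laplace (S - t *: A j)%R)%E.
  have := lamin (lam + t *: delta_mx 0 j); rewrite /dual_obj slack_delta -/S.
  rewrite dotpDl dotpZl dotp_deltal opprD expRD EFinM -muleA.
  by rewrite lee_pmul2l// lte_fin expR_gt0.
have mt j : measurable_fun (pd R d) (trip (A j)).
  by apply: measurable_funTS; exact: measurable_trip.
have mom : has_moments Q A y.
  move=> j; have [fi fI] := fo j (hmin j).
  have qE : (fun X => trip (A j) X * gibbs_pdf S X) =
      fun X => gibbs_const S * (expR (- trip S X) * trip (A j) X).
    by apply/funext => X; rewrite /gibbs_pdf; ring.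
  have qi : int (fun X => trip (A j) X * gibbs_pdf S X) by rewrite qE; exact: intZ.
  split; first exact/(integrable_density mpd mq q0 QE (mt j)).
  rewrite (integral_density mpd mq q0 QE (mt j)).
  rewrite (Rintegral_EFin qi) qE RintegralZl// fI Rintegral_expR mulrCA mulVf ?mulr1//.
  by rewrite gt_eqF// fine_gt0// laplace_gt0 laplace_lty.
exists Q, (gibbs_pdf S); split => //.
have tripS X : trip S X = trip A0 X - dotp lam (hmap A X) by exact: trip_slack.
move: S tripS hS Qq {mq q0 QE fo hmin} => S tripS hS Qq.
have [dI dE] := pdf_dotp Qq mom lam.
have qI := integrable_gibbs_pdf hS.
rewrite /rel_entropy.
rewrite (eq_integral (fun X => ((ln (gibbs_const S) - ln c0) * gibbs_pdf S X +
    dotp lam (hmap A X) * gibbs_pdf S X)%:E)); last first.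
  move=> X _; rewrite ln_gibbs_pdf_div// tripS subKr; congr EFin.
  by rewrite [LHS]mulrC [LHS]mulrDl.
have i1 := intZ (ln (gibbs_const S) - ln c0) qI.
rewrite (Rintegral_EFin (intD i1 dI)) RintegralD// RintegralZl// dE.
rewrite Rintegral_gibbs_pdf//; congr EFin.
by rewrite mulr1 addrC addrA.
Qed.

Lemma strong_duality y : interior_moment A y ->
  exists2 lam, pd R d (sl lam) &
    Theta A0 A y = (dotp lam y + ln (gibbs_const (sl lam)) - ln c0)%:E /\
    forall mu, psd R d (sl mu) ->
      ((dotp mu y)%:E - log_barrier (sl mu) - (ln c0)%:E <= Theta A0 A y)%E.
Proof.
move=> hy; have [lam [hS lamin]] := dual_attained hA0 hy.
have [Q [q [Qd Qq Qm Qe]]] := primal_point hS lamin.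
have wd mu : psd R d (sl mu) ->
    ((dotp mu y)%:E - log_barrier (sl mu) - (ln c0)%:E <= Theta A0 A y)%E.
  move=> hmu; apply: le_ereal_inf_tmp => _ [Q' [q' [_ Qq' Qm' ->]]].
  exact: weak_duality Qq' Qm' _ hmu.
exists lam => //; split=> //; apply/eqP; rewrite eq_le; apply/andP; split.
  by rewrite -Qe; apply: ereal_inf_lbound; exists Q, q.
have := wd _ (pd_psd hS); rewrite log_barrierE// -EFinN -!EFinD opprK.
by [].
Qed.

End duality.

(** * Vanishing barrier weight *)

Section regularized_sup.
Context (R : realType).

(** Abstract form of the limit: f r is the maximum of D + r L over F, while D is at
most t on F and comes close to t on P. Shrinking moves points of P into F at
little cost, which gives the lower bound; L is at most an affine decreasing function of D, so a large
value of L cannot compensate a small value of D once r < 2, which gives the upper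
bound. *)
Lemma cvg_regularized_sup (T : Type) (F P : T -> Prop) (D L : T -> R)
    (f : R -> \bar R) (t a : R) :
  (forall r, 0 < r -> exists lam, [/\ F lam, f r = (D lam + r * L lam)%:E &
     forall mu, F mu -> D mu + r * L mu <= D lam + r * L lam]) ->
  (forall lam, F lam -> D lam <= t) ->
  (forall e, 0 < e -> exists2 lam, P lam & t - e < D lam) ->
  (forall lam x, P lam -> 0 < x -> x < 1 ->
     exists2 mu, F mu & D mu = (1 - x) * D lam) ->
  (forall lam, F lam -> L lam <= a - D lam / 2) ->
  f r @[r --> 0^'+] --> t%:E.
Proof.
move=> fmax tub tsup shrink Lub.
have fE r : 0 < r -> f r = (fine (f r))%:E by move=> /fmax[lam [_ -> _]].
have fge r mu : 0 < r -> F mu -> D mu + r * L mu <= fine (f r).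
  by move=> /fmax[lam [_ -> h]] /h.
pose K := a - t / 2.
have fle r : 0 < r -> r < 2 -> fine (f r) <= t + r * K.
  move=> r0 r2; have [lam [hF -> _]] := fmax r r0.
  have h1 : r * L lam <= r * (a - D lam / 2) by rewrite ler_pM2l// Lub.
  have h2 : (1 - r / 2) * D lam <= (1 - r / 2) * t.
    by rewrite ler_wpM2l ?tub//; lra.
  by rewrite /= /K; nra.
apply/fine_cvgP; split.
  by near=> r; rewrite fE.
apply/cvgrPdist_le => e e0.
have [lam hlam lamt] : exists2 lam, P lam & t - e / 4 < D lam.
  by apply: tsup; rewrite divr_gt0.
(* shrinking lam by the factor 1 - x loses at most e / 4 of D lam *)
pose x := Num.min (2^-1) (e / 4 / (`|D lam| + 1)).
have nD : 0 < `|D lam| + 1 by rewrite ltr_wpDl.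
have x0 : 0 < x by rewrite lt_min invr_gt0 ltr0n !divr_gt0.
have x1 : x <= 2^-1 by rewrite ge_min lexx.
have xD : x * D lam <= e / 4.
  have : x * (`|D lam| + 1) <= e / 4.
    by rewrite -ler_pdivlMr// ge_min lexx orbT.
  by apply: le_trans; rewrite ler_pM2l//; have := ler_norm (D lam); lra.
have [|mu hmu muE] := shrink lam x hlam x0; first by lra.
near=> r.
have r0 : 0 < r by near: r; exact: nbhs_right_gt.
have r2 : r < 2 by near: r; exact: nbhs_right_lt.
have rK : r * (`|K| + 1) <= e / 4.
  rewrite -ler_pdivlMr ?ltr_wpDl//; near: r; apply: nbhs_right_le.
  by rewrite !divr_gt0// ltr_wpDl.
have rL : r * (`|L mu| + 1) <= e / 4.
  rewrite -ler_pdivlMr ?ltr_wpDl//; near: r; apply: nbhs_right_le.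
  by rewrite !divr_gt0// ltr_wpDl.
have hle := fle r r0 r2; have hge := fge r mu r0 hmu; rewrite muE in hge.
have K1 : r * K <= r * (`|K| + 1).
  by rewrite ler_pM2l//; have := ler_norm K; lra.
have L1 : r * (- L mu) <= r * (`|L mu| + 1).
  by rewrite ler_pM2l//; have := ler_norm (- L mu); rewrite normrN; lra.
rewrite /= ler_norml; move: rK rL hle hge K1 L1 xD lamt; rewrite mulrN mulrBl mul1r.
move: (r * (`|K| + 1)) (r * K) (r * (`|L mu| + 1)) (r * L mu) (x * D lam).
move: (fine (f r)) (D lam) => p q k1 k2 l1 l2 z *.
by apply/andP; split; lra.
Unshelve. all: by end_near. Qed.

Lemma mul_affineK (e u v w : R) : e != 0 -> e * (e^-1 * u + v - w) = u + e * (v - w).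
Proof. by move=> e0; rewrite -addrA mulrDr mulVKf. Qed.

Lemma le_mul_affine (e u v w u' v' w' : R) : 0 < e ->
  e^-1 * u + v - w <= e^-1 * u' + v' - w' ->
  u + e * (v - w) <= u' + e * (v' - w').
Proof.
by move=> e0; rewrite -(ler_pM2l e0) !mul_affineK// gt_eqF.
Qed.

Lemma le_half_sub (x u v b c : R) :
  x <= (u - v) / 2 - b -> x - c <= u / 2 - b - c - v / 2.
Proof. by move=> h; lra. Qed.

Lemma le_affineK (e u v w u' v' : R) :
  (u + e * (v - w) <= u' + e * (v' - w)) = (u + e * v <= u' + e * v').
Proof. by rewrite !mulrBr !addrA lerD2r. Qed.

Lemma laplace_lower_ln (b x z : R) : 0 < b -> 0 < z ->
  b * expR (- x) <= z -> ln z^-1 <= x - ln b.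
Proof.
move=> b0 z0 h; have : ln (b * expR (- x)) <= ln z.
  by rewrite ler_ln ?posrE// mulr_gt0 ?expR_gt0.
by rewrite lnM ?posrE ?expR_gt0// expRK lnV ?posrE//; lra.
Qed.
End regularized_sup.

Section limit.
Context (R : realType) (d m : nat).
Implicit Types (S V W X : sym R d) (y lam mu : 'rV[R]_m).
Context (A0 : sym R d) (A : 'I_m -> sym R d).
Hypothesis hA0 : pd R d A0.
Local Notation sl lam := (slack A0 A lam).
Local Notation c0 := (gibbs_const A0).

Lemma log_barrier_psd S : log_barrier S = +oo%E \/
  pd R d S /\ log_barrier S = (- ln (gibbs_const S))%:E.
Proof.
have [Soo|] := boolP (laplace S < +oo)%E.
  by right; have pS := laplace_lty_pd Soo; rewrite log_barrierE.
by rewrite -leNgt leye_eq => /eqP Soo; left; rewrite /log_barrier Soo.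
Qed.

(** Strong duality at y / e, multiplied by e. *)
Lemma perspective_attained y e : 0 < e -> interior_moment A y ->
  exists2 lam, pd R d (sl lam) &
    perspective (Theta A0 A) y e =
      (dotp lam y + e * (ln (gibbs_const (sl lam)) - ln c0))%:E /\
    forall mu, pd R d (sl mu) ->
      dotp mu y + e * (ln (gibbs_const (sl mu)) - ln c0) <=
      dotp lam y + e * (ln (gibbs_const (sl lam)) - ln c0).
Proof.
move=> e0 hy; have eV0 : 0 < e^-1 by rewrite invr_gt0.
have [lam hlam [TE wd]] := strong_duality hA0 (interior_momentZ eV0 hy).
have en0 : e != 0 by rewrite gt_eqF.
exists lam; [exact: hlam|split].
  by rewrite /perspective TE -EFinM dotpZr (mul_affineK _ _ _ en0).
move=> mu hmu; have := wd mu (pd_psd hmu).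
rewrite (log_barrierE hmu) TE -EFinN -!EFinD lee_fin opprK !dotpZr.
exact: (le_mul_affine e0).
Qed.

Lemma perspective_tau_eps y e : 0 < e -> interior_moment A y ->
  perspective (Theta A0 A) y e = ((- (e * ln c0))%:E + tau_eps A0 A e y)%E.
Proof.
move=> e0 hy; have [lam hlam [-> lammax]] := perspective_attained e0 hy.
suff -> : tau_eps A0 A e y = (dotp lam y + e * ln (gibbs_const (sl lam)))%:E.
  by rewrite -EFinD; congr EFin; rewrite mulrBr addrA addrC.
apply/eqP; rewrite eq_le; apply/andP; split.
  apply: ge_ereal_sup => _ [mu /= hmu <-].
  case: (log_barrier_psd (sl mu)) => [->|[pmu ->]].
    by rewrite gt0_muley ?lte_fin// leNye.
  have := lammax mu pmu; rewrite le_affineK => le_lam.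
  rewrite -EFinM -EFinN -EFinD lee_fin mulrN opprK; exact: le_lam.
apply: ereal_sup_ubound; exists lam; first exact: pd_psd hlam.
by rewrite (log_barrierE hlam) -EFinM -EFinN -EFinD mulrN opprK.
Qed.

(** Feasible lam satisfy 0 <= <S(lam), X0> = <A0, X0> - <lam, y>. *)
Lemma tau_fin_num y : interior_moment A y -> tau A0 A y \is a fin_num.
Proof.
move=> hy; have [X0 hX0 X0E] := pd_moment hy.
rewrite fin_numElt; apply/andP; split.
  apply: (@lt_le_trans _ _ (dotp 0 y)%:E); first by rewrite ltNyr.
  by apply: ereal_sup_ubound; exists 0 => //=; rewrite slack0; exact: pd_psd.
apply: (@le_lt_trans _ _ (trip A0 X0)%:E); last by rewrite ltry.
apply: ge_ereal_sup => _ [mu /= hmu <-]; rewrite lee_fin.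
have := trip_ge0 hmu (pd_psd hX0); rewrite trip_slack X0E subr_ge0.
by [].
Qed.

Lemma cvg_perspective_tau y : interior_moment A y ->
  perspective (Theta A0 A) y r @[r --> 0^'+] --> tau A0 A y.
Proof.
move=> hy; have tfin := tau_fin_num hy.
rewrite -(fineK tfin); set t := fine (tau A0 A y).
have tE : tau A0 A y = t%:E by rewrite fineK.
have [X0 hX0 X0E] := pd_moment hy.
have [b b0 bP] := laplace_lower hX0.
apply: (@cvg_regularized_sup _ _ (fun lam => pd R d (sl lam))
  (fun lam => psd R d (sl lam)) (fun lam => dotp lam y)
  (fun lam => ln (gibbs_const (sl lam)) - ln c0) _ t
  (trip A0 X0 / 2 - ln b - ln c0)).
- move=> r r0; have [lam hlam [fE lammax]] := perspective_attained r0 hy.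
  by exists lam; split; [exact: hlam|exact: fE|exact: lammax].
- move=> lam /pd_psd hlam; rewrite -lee_fin -tE.
  by apply: ereal_sup_ubound; exists lam; [exact: hlam|].
- move=> e e0; have [_ [lam hlam <-]] := ub_ereal_sup_adherent e0 tfin.
  rewrite -/(tau A0 A y) tE -EFinN -EFinD lte_fin => lamt.
  by exists lam; [exact: hlam|exact: lamt].
- move=> lam x hlam x0 x1; exists ((1 - x) *: lam); last exact: dotpZl.
  rewrite slackZ subKr addrC; apply: pdD; first exact: pdZ x0 hA0.
  by apply: psdZ hlam; rewrite subr_ge0 ltW.
- move=> lam hlam; have := bP _ (pd_psd hlam).
  have z0 : 0 < fine (laplace (sl lam)).
    by rewrite fine_gt0// laplace_gt0 laplace_lty.
  rewrite -[laplace _](fineK (laplace_fin_num hlam)) lee_fin.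
  move=> /(laplace_lower_ln b0 z0); rewrite -/(gibbs_const (sl lam)).
  rewrite trip_slack X0E => h.
  exact: le_half_sub h.
Qed.

End limit.

Unset Implicit Arguments.

Theorem theorem4p3 (R : realType) (d m : nat)
    (hmd : (m <= d)%N) (hms : (m < (d * d.+1)./2)%N)
    (A : 'I_m -> sym R d) (hA : free [tuple A j | j < m])
    (A0 : sym R d) (hA0 : pd R d A0)
    (hj : 0 < gram_jacobian A)
    (y : 'rV[R]_m) (hy : interior (hmap A @` psd R d) y) :
  (forall e : R, 0 < e ->
     perspective (Theta A0 A) y e =
       ((- (e * ln (gibbs_const A0)))%:E + tau_eps A0 A e y)%E) /\
  perspective (Theta A0 A) y r @[r --> 0^'+] --> tau A0 A y.
Proof.
have hy' := interior_momentP hy; split; last exact: cvg_perspective_tau.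
by move=> e e0; exact: perspective_tau_eps.
Qed.
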